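(* Let $A$ be the $C^*$-algebra constructed in the context (for any choice of the data described there), and let $\widetilde\tau$ be its unique tracial state. Then $A$ has no nonzero irreducible representation on a separable Hilbert space. The (faithful) GNS representation of $\widetilde\tau$ has no nonzero irreducible closed subrepresentation.
   Context: Conventions. Algebras and Hilbert spaces are complex; inner products are linear in the first variable; for vectors $x,y$, $\theta_{x,y}z=\langle z,y\rangle x$. A representation is a $*$-homomorphism into $\mathcal B(K)$. Strong limits are limits in the strong operator topology. A closed subrepresentation is the restriction of a representation to a closed invariant subspace. CAR algebra. $C=\overline{\bigcup_{n\ge0}C_n}$ with $C_n=M_2(\mathbb C)^{\otimes n}$ embedded in $C_{n+1}$ by $a\mapsto a\otimes1_2$. Its unique tracial state is $\tau(a)=2^{-n}\operatorname{Tr}(a)$, $a\in C_n$. Let $e_{00}\in M_2(\mathbb C)$ be the first diagonal matrix unit, $q_n=e_{00}^{\otimes n}\in C$ (so $q_0=1$ and $q_n$ is decreasing), and let $\phi_{\mathrm r}$ be the pure product state of $C$ selecting the first coordinate in each tensor factor, i.e. the product of the vector states $a\mapsto a_{00}$ on $M_2(\mathbb C)$. Pure-state data. Choose pure states $(\phi_i)_{i\in I}$ of $C$, with GNS triples $(H_i,\pi_i,\xi_i)$, such that $(\pi_i)_{i\in I}$ contains exactly one representative of each unitary equivalence class of irreducible representations of $C$, with a distinguished index $\mathrm r\in I$ corresponding to $\phi_{\mathrm r}$. For each $i\in I$ choose an automorphism $\alpha_i$ of $C$ with $\phi_i\circ\alpha_i=\phi_{\mathrm r}$ and $\alpha_{\mathrm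 r}=\mathrm{id}_C$ which is asymptotically inner: there is a norm-continuous path $t\mapsto u_{i,t}$ ($t\ge0$) of unitaries of $C$ with $u_{i,0}=1$ and $\lim_{t\to\infty}\|\alpha_i(a)-u_{i,t}au_{i,t}^*\|=0$ for all $a\in C$. (Such $\alpha_i$ exist by the Kishimoto–Ozawa–Sakai homogeneity theorem.) Put, for $n\ge0$, $p_{i,n}=\alpha_i(q_n)$, $f_n=q_n-q_{n+1}$, $e_{i,n}=p_{i,n}-p_{i,n+1}$. Choose $w_{i,n}\in C$ with $w_{i,n}^*w_{i,n}=e_{i,n}$, $w_{i,n}w_{i,n}^*=f_n$, $w_{\mathrm r,n}=f_n$ (such elements exist), and put $s_{i,N}=\sum_{n=0}^{N-1}w_{i,n}\in C$. The algebra. Let $H=\bigoplus_{i\in I}H_i$, $\Pi=\bigoplus_{i\in I}\pi_i:C\to\mathcal B(H)$, and let $\zeta_i\in H$ be the image of $\xi_i$ under the coordinate inclusion $H_i\to H$. Let $S_i$ be the strong limit of $\Pi(s_{i,N})$ as $N\to\infty$ (which exists) and $L_i=S_i+\theta_{\zeta_{\mathrm r},\zeta_i}$, which is a unitary on $H$. Define $A=C^*(\Pi(C),\{L_i:i\in I\})\subseteq\mathcal B(H)$, and $j:C\to A$, $j(a)=\Pi(a)$. The algebra $A$ has a unique tracial state $\widetilde\tau$, which satisfies $\widetilde\tau\circ j=\tau$ and is faithful. *)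

(* Defs.v *)
From HB Require Import structures.
From mathcomp Require Import all_boot all_order all_algebra.
From mathcomp Require Import sesquilinear complex mxtens.
From mathcomp Require Import all_classical all_reals all_analysis.

Set Implicit Arguments.
Unset Strict Implicit.
Unset Printing Implicit Defensive.

Import Order.TTheory GRing.Theory Num.Theory.
Import numFieldNormedType.Exports.

Local Open Scope classical_set_scope.
Local Open Scope complex_scope.
Local Open Scope ring_scope.

(* [{dot T for Num.conj}] is linear in its first argument. *)
HB.mixin Record isHilbert (R : realType) T of CompleteNormedModule R[i] T := {
  inner : {dot T for (Num.conj : R[i] -> R[i])} ;
  sqr_norm_inner : forall x : T, `|x| ^+ 2 = inner x x }.

#[short(type="hilbertType")]
HB.structure Definition Hilbert (R : realType) :=
  {T of CompleteNormedModule R[i] T & isHilbert R T}.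

(* Unital C*-algebras with [1 != 0].  The norm is a field of its own: a type
   cannot be made both a [nzRingType] and a [normedZmodType] without being a
   [numDomainType] in the hierarchy. *)
HB.mixin Record isCStar (R : realType) T of GRing.Algebra R[i] T := {
  star : T -> T ;
  cnorm : T -> R ;
  starK : involutive star ;
  star_antilinear : forall (c : R[i]) (x y : T),
    star (c *: x + y) = Num.conj c *: star x + star y ;
  starM : forall x y : T, star (x * y) = star y * star x ;
  cnorm0_eq0 : forall x : T, cnorm x = 0 -> x = 0 ;
  cnormZ : forall (c : R[i]) (x : T), (cnorm (c *: x))%:C = `|c| * (cnorm x)%:C ;
  cnormD : forall x y : T, cnorm (x + y) <= cnorm x + cnorm y ;
  cnormM : forall x y : T, cnorm (x * y) <= cnorm x * cnorm y ;
  cstar_identity : forall x : T, cnorm (star x * x) = cnorm x ^+ 2 ;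
  cnorm_complete : forall u : nat -> T,
    (forall e : R, 0 < e -> exists N, forall m n, (N <= m)%N -> (N <= n)%N ->
      cnorm (u m - u n) < e) ->
    exists l, cnorm (u n - l) @[n --> \oo] --> (0 : R) }.

#[short(type="cstarType")]
HB.structure Definition CStar (R : realType) :=
  {T of GRing.Algebra R[i] T & isCStar R T}.

Section Operators.
Context {R : realType}.

Definition bounded_op (H K : hilbertType R) (T : H -> K) : Prop :=
  linear T /\ continuous T.

Definition is_adjoint (H : hilbertType R) (T T' : H -> H) : Prop :=
  forall x y, inner (T x) y = inner x (T' y).

Definition theta (H : hilbertType R) (x y z : H) : H := inner z y *: x.

Definition closed_subspace (K : hilbertType R) (M : set K) : Prop :=
  [/\ M 0, (forall (c : R[i]) x y, M x -> M y -> M (c *: x + y)) & closed M].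

Definition separable_space (K : hilbertType R) : Prop :=
  exists2 D : set K, countable D & dense D.

(* [V i] are the coordinate inclusions of the Hilbert space direct sum. *)
Definition hilbert_direct_sum (I : Type) (Hs : I -> hilbertType R)
    (H : hilbertType R) (V : forall i, Hs i -> H) : Prop :=
  [/\ forall i, linear (V i),
      forall i x y, inner (V i x) (V i y) = inner x y,
      forall i j x y, i <> j -> inner (V i x) (V j y) = 0 &
      forall M : set H, closed_subspace M -> (forall i x, M (V i x)) ->
        M = setT].

Record cstar_subalgebra (H : hilbertType R) (B : set (H -> H)) : Prop := {
  cstar_sub_bounded : forall T, B T -> bounded_op T ;
  cstar_sub_linear : forall (c : R[i]) T T', B T -> B T' ->
    B (fun x => c *: T x + T' x) ;
  cstar_sub_comp : forall T T', B T -> B T' -> B (T \o T') ;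
  cstar_sub_adjoint : forall T T', B T -> bounded_op T' -> is_adjoint T T' ->
    B T' ;
  (* closedness in operator norm *)
  cstar_sub_closed : forall T, bounded_op T ->
    (forall e : R[i], 0 < e ->
      exists2 T', B T' & forall x, `|T x - T' x| <= e * `|x|) ->
    B T }.

Definition cstar_generated (H : hilbertType R) (G : set (H -> H)) :
    set (H -> H) :=
  [set T | forall B, cstar_subalgebra B -> G `<=` B -> B T].

End Operators.

Section Representations.
Context {R : realType} (A : cstarType R).

Record representation (K : hilbertType R) (rho : A -> K -> K) : Prop := {
  rep_bounded : forall a, bounded_op (rho a) ;
  rep_linear : forall (c : R[i]) a b x,
    rho (c *: a + b) x = c *: rho a x + rho b x ;
  rep_mul : forall a b x, rho (a * b) x = rho a (rho b x) ;
  rep_star : forall a, is_adjoint (rho a) (rho (star a)) }.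

Definition invariant_subspace (K : hilbertType R) (rho : A -> K -> K)
    (M : set K) : Prop :=
  closed_subspace M /\ forall a x, M x -> M (rho a x).

(* The next two notions concern the restriction of [rho] to a closed invariant
   subspace [M]; [M = setT] gives [rho] itself. *)
Definition nonzero_on (K : hilbertType R) (rho : A -> K -> K) (M : set K) :
    Prop :=
  exists a, exists2 x, M x & rho a x <> 0.

Definition irreducible_on (K : hilbertType R) (rho : A -> K -> K)
    (M : set K) : Prop :=
  forall N, invariant_subspace rho N -> N `<=` M -> N = [set 0] \/ N = M.

Definition nonzero_irreducible_rep (K : hilbertType R) (rho : A -> K -> K) :
    Prop :=
  [/\ representation rho, nonzero_on rho setT & irreducible_on rho setT].

Definition unitarily_equivalent (K1 K2 : hilbertType R)
    (rho1 : A -> K1 -> K1) (rho2 : A -> K2 -> K2) : Prop :=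
  exists U : K1 -> K2,
    [/\ linear U, forall x y, inner (U x) (U y) = inner x y,
        forall y, exists x, U x = y &
        forall a x, U (rho1 a x) = rho2 a (U x)].

Definition state (phi : {scalar A}) : Prop :=
  (forall a, 0 <= phi (star a * a)) /\ phi 1 = 1.

Definition pure_state (phi : {scalar A}) : Prop :=
  state phi /\
  forall (psi1 psi2 : {scalar A}) (t : R), state psi1 -> state psi2 ->
    0 < t < 1 ->
    (forall a, phi a = t%:C * psi1 a + (1 - t)%:C * psi2 a) ->
    (forall a, psi1 a = phi a) /\ (forall a, psi2 a = phi a).

Definition tracial_state (phi : {scalar A}) : Prop :=
  state phi /\ forall a b, phi (a * b) = phi (b * a).

Definition gns_triple (phi : {scalar A}) (K : hilbertType R)
    (rho : A -> K -> K) (xi : K) : Prop :=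
  [/\ representation rho,
      closure (range (fun a => rho a xi)) = setT &
      forall a, phi a = inner (rho a xi) xi].

Definition unitary (u : A) : Prop := star u * u = 1 /\ u * star u = 1.

Definition star_automorphism (alpha : A -> A) : Prop :=
  [/\ linear alpha, forall a b, alpha (a * b) = alpha a * alpha b,
      forall a, alpha (star a) = star (alpha a) & bijective alpha].

Definition asymptotically_inner (alpha : A -> A) : Prop :=
  exists u : R -> A,
    [/\ forall t, 0 <= t ->
          cnorm (u t' - u t) @[t' --> within [set t' | 0 <= t'] (nbhs t)]
            --> (0 : R),
        forall t, 0 <= t -> unitary (u t),
        u 0 = 1 &
        forall a, cnorm (alpha a - u t * a * star (u t)) @[t --> +oo] --> (0 : R)].

End Representations.

Section CAR.
Context {R : realType}.

(* The size [2 ^ n] of [C_n], arranged so that [a *t 1%:M] needs no cast. *)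
Fixpoint cdim (n : nat) : nat := if n is m.+1 then (cdim m * 2)%N else 1%N.

(* [elem_tensor a n] is [a_0 (x) ... (x) a_(n-1)]. *)
Fixpoint elem_tensor (a : nat -> 'M[R[i]]_2) (n : nat) : 'M[R[i]]_(cdim n) :=
  if n is m.+1 return 'M[R[i]]_(cdim n) then elem_tensor a m *t a m else 1%:M.

(* [C], with the maps [iota n] from [C_n] to [C], is the CAR algebra. *)
Record car_algebra (C : cstarType R)
    (iota : forall n, 'M[R[i]]_(cdim n) -> C) : Prop := {
  car_linear : forall n, linear (iota n) ;
  car_mul : forall n a b, iota n (a *m b) = iota n a * iota n b ;
  car_one : forall n, iota n 1%:M = 1 ;
  car_star : forall n a, iota n (map_mx Num.conj a^T) = star (iota n a) ;
  car_inj : forall n, injective (iota n) ;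
  car_compat : forall n a, iota n.+1 (a *t (1%:M : 'M[R[i]]_2)) = iota n a ;
  car_dense : forall (x : C) (e : R), 0 < e ->
    exists n a, cnorm (x - iota n a) < e }.

Variables (C : cstarType R) (iota : forall n, 'M[R[i]]_(cdim n) -> C).

Definition car_q (n : nat) : C :=
  iota (elem_tensor (fun _ => delta_mx 0 0) n).

Definition car_f (n : nat) : C := car_q n - car_q n.+1.

(* The product of the vector states [a |-> a 0 0]. *)
Definition first_coordinate_product_state (phi : {scalar C}) : Prop :=
  forall (a : nat -> 'M[R[i]]_2) (n : nat),
    phi (iota (elem_tensor a n)) = \prod_(k < n) a k 0 0.

End CAR.

(* Main.v *)
Require Import Defs.
From HB Require Import structures.
From mathcomp Require Import all_boot all_order all_algebra.
From mathcomp Require Import sesquilinear complex mxtens.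
From mathcomp Require Import all_classical all_reals all_analysis.
From mathcomp Require Import ring lra.
Set Implicit Arguments.
Unset Strict Implicit.
Unset Printing Implicit Defensive.
Import Order.TTheory GRing.Theory Num.Theory.
Import numFieldNormedType.Exports.
Local Open Scope classical_set_scope.
Local Open Scope complex_scope.
Local Open Scope ring_scope.

(** Let [j] be the inclusion of [C] in [A], let [l i] be [L i] as an element of [A],
and let [q n] be the projections [car_q iota n], so that [p i n = alpha i (q n)].  For a
representation [rho] of [A], let [K_i] be the space of the vectors fixed by all
the [rho (j (p i n))].  The projections [p i n] decrease to the pure state [phi i],
so a unit vector of [K_i] has the vector state [phi i] on [C], and generates under
[C] a copy of [pi i].

In [A] the element [l i] is unitary, and
[[
  j (q n) * l i = l i * j (p i n) = l i - j (s i n)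
]]
([construction_linked]).  Unitarity is where it matters that every irreducible
representation of [C] occurs exactly once in [Pi]: it makes [Pi (p i n)] tend
strongly to the projection on the line of [zeta i] ([excision_limit]), which is
exactly what the rank one term of [L i] compensates.

The two equalities have two consequences in any [rho].  First, [rho (l i)] maps
[K_i] onto [K_r], so as soon as one [K_i] is nonzero all are.  Secondly, if all
[K_i] vanish then [rho (j (p i n))] tends strongly to [0], so [rho (l i)] and its
adjoint are strong limits of elements of [rho (j C)], and closed subspaces
invariant under [C] are invariant under [A].  An irreducible [rho] then stays
irreducible on [C], hence is equivalent to some [pi i], whose vector [xi i] makes
[K_i] nonzero.  So an irreducible representation of [A] always has a nonzero
vector in some [K_i] ([irreducible_has_state]; it is stated for the restriction
to a closed invariant subspace).

In the GNS representation of a trace this cannot happen, because the trace of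
[p i n] is [2^-n] and tends to [0] ([trace_gns_no_state]).

In an irreducible representation on a separable space it cannot happen either
([separable_no_state]).  For each sequence of bits [eps] the product pure state
that selects the coordinate [eps k] in the factor [k] lives in some [pi i], hence in
[K] because [K_i] is nonzero; this gives a unit vector fixed by all the diagonal
projections following [eps].  Two different sequences give orthogonal projections
at some stage, so these vectors form an uncountable orthonormal family.

As [A] is an operator norm closure, invariance under [A] is
deduced from invariance under the generators by the continuity of [rho] for that
norm.  It follows from the existence of a square root of [1 - a^* a] when [a] is
small ([rep_bound]); the iteration which produces it runs in the operator norm,
for which [A] is complete because its range is closed. *)

(** * Scalars, sequences and inner products *)

Section RealScalars.
Context {R : realType}.

Lemma ge0_realC (z : R[i]) : 0 <= z -> exists2 t : R, 0 <= t & t%:C = z.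
Proof. by case: z => a b; rewrite lecE /= => /andP[/eqP -> a0]; exists a. Qed.

Lemma gt0_realC (z : R[i]) : 0 < z -> exists2 t : R, 0 < t & t%:C = z.
Proof. by case: z => a b; rewrite ltcE /= => /andP[/eqP -> a0]; exists a. Qed.

Lemma inv_succ_small (e : R) : 0 < e ->
  exists N, forall n, (N <= n)%N -> n.+1%:R^-1 < e.
Proof.
move=> e0; exists (Num.truncn e^-1) => n Nn; rewrite invf_plt ?posrE //.
by apply: lt_le_trans (Num.Theory.truncnS_gt _) _; rewrite ler_nat ltnS.
Qed.

End RealScalars.

Section NormedSequences.
Context {F : numFieldType} {V : normedModType F}.
Implicit Types (u : nat -> V) (l : V).

Lemma cvg_seqP u l : u n @[n --> \oo] --> l <->
  forall e : F, 0 < e -> exists N, forall n, (N <= n)%N -> `|u n - l| < e.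
Proof.
split=> [/cvgrPdist_lt ul e e0|ul].
  have [N _ NP] := ul _ e0; exists N => n Nn; rewrite distrC; exact: NP.
apply/cvgrPdist_lt => e e0; have [N NP] := ul _ e0.
by exists N => // n /= Nn; rewrite distrC; exact: NP.
Qed.

Lemma cvg_seq_uniq u l l' :
  u n @[n --> \oo] --> l -> u n @[n --> \oo] --> l' -> l = l'.
Proof. by move=> ul ul'; exact: cvg_unique ul ul'. Qed.

Lemma closed_seq (M : set V) u l :
  closed M -> (forall n, M (u n)) -> u n @[n --> \oo] --> l -> M l.
Proof.
move=> cM Mu ul; apply: (@closed_cvg _ _ \oo _ u M cM _ l ul).
exact: nearW.
Qed.

Lemma density_dist (T : Type) (f : T -> V) (x : V) (e : F) :
  closure (range f) x -> 0 < e -> exists a, `|f a - x| < e.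
Proof.
move=> cl e0; have [_ [[a _ <-]]] := cl _ (nbhsx_ballx x e e0).
by rewrite -ball_normE /= distrC => h; exists a.
Qed.

Lemma small_norm0 (x : V) : (forall e : F, 0 < e -> `|x| < e) -> x = 0.
Proof.
move=> h; apply/eqP; apply/negPn/negP; rewrite -normr_gt0 => x0.
by have := h _ x0; rewrite ltxx.
Qed.

End NormedSequences.

Section Hilbert.
Context {R : realType}.
Implicit Types (H K : hilbertType R).
Local Notation C := R[i].

Lemma innerC H (x y : H) : inner x y = Num.conj (inner y x).
Proof. by rewrite hermC expr0 mul1r. Qed.

Lemma innerDl H (x y z : H) : inner (x + y) z = inner x z + inner y z.
Proof. exact: linearDl. Qed.
Lemma innerDr H (x y z : H) : inner z (x + y) = inner z x + inner z y.
Proof. exact: linearDr. Qed.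
Lemma innerBl H (x y z : H) : inner (x - y) z = inner x z - inner y z.
Proof. exact: linearBl. Qed.
Lemma innerBr H (x y z : H) : inner z (x - y) = inner z x - inner z y.
Proof. exact: linearBr. Qed.
Lemma innerZl H (c : C) (x z : H) : inner (c *: x) z = c * inner x z.
Proof. exact: linearZl_LR. Qed.
Lemma innerZr H (c : C) (x z : H) : inner z (c *: x) = Num.conj c * inner z x.
Proof. exact: linearZr_LR. Qed.
Lemma inner0l H (z : H) : inner 0 z = 0. Proof. exact: linear0l. Qed.
Lemma inner0r H (z : H) : inner z 0 = 0. Proof. exact: linear0r. Qed.

Lemma inner_norm H (x : H) : inner x x = `|x| ^+ 2.
Proof. by rewrite sqr_norm_inner. Qed.

Lemma cauchy_schwarz H (x y : H) : `|inner x y| <= `|x| * `|y|.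
Proof.
have [->|y0] := eqVneq y 0; first by rewrite inner0r !normr0 mulr0.
have ny : 0 < `|y| by rewrite normr_gt0.
rewrite -ler_sqr ?nnegrE ?mulr_ge0 //.
(* The projection of [x] on the line of [y] is [a *: y]. *)
pose a := inner x y / `|y| ^+ 2.
have h : 0 <= inner (x - a *: y) (x - a *: y) by exact: dnorm_ge0.
move: h; rewrite innerBl !innerBr innerZl !innerZr innerZl !inner_norm.
have -> : inner y x = Num.conj (inner x y) by rewrite innerC.
have y2 : `|y| ^+ 2 != 0 by rewrite expf_neq0 // gt_eqF.
have cc : Num.conj a = Num.conj (inner x y) / `|y| ^+ 2.
  by rewrite /a rmorphM /= fmorphV /= rmorphXn /= (conj_Creal (normr_real y)).
have -> : Num.conj a * (a * `|y| ^+ 2) = a * Num.conj (inner x y).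
  by rewrite mulrCA cc mulfVK.
rewrite subrr subr0 cc mulrAC [_ * inner x y]mulrC -normCK.
by rewrite subr_ge0 ler_pdivrMr ?exprn_gt0 // -exprMn.
Qed.

Lemma inner_cvg H (u v : nat -> H) (x y : H) :
  u n @[n --> \oo] --> x -> v n @[n --> \oo] --> y ->
  inner (u n) (v n) @[n --> \oo] --> inner x y.
Proof.
move=> ux vy; apply/(@cvg_seqP _ C^o) => e e0.
have D0 : 0 < `|x| + `|y| + 2 by rewrite ltr_wpDl // addr_ge0.
have q0 : 0 < e / (`|x| + `|y| + 2) by exact: divr_gt0.
(* The order of [R[i]] is partial, so the comparability of the two terms of the
   minimum has to be supplied. *)
have [d [d0 d1 hd]] : exists d : C, [/\ 0 < d, d <= 1 & d * (`|x| + `|y| + 1) < e].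
  have R01 : (1 : C) >=< (e / (`|x| + `|y| + 2)).
    by apply: real_comparable; [exact: real1|exact: gtr0_real].
  exists (Num.min 1 (e / (`|x| + `|y| + 2))).
  have mc : Num.min 1 (e / (`|x| + `|y| + 2)) <= e / (`|x| + `|y| + 2).
    by rewrite comparable_ge_min // lexx orbT.
  split.
  - by rewrite comparable_lt_min // ltr01 q0.
  - by rewrite comparable_ge_min // lexx.
  - apply: le_lt_trans (_ : (e / (`|x| + `|y| + 2)) * (`|x| + `|y| + 1) < _).
      by rewrite ler_wpM2r // addr_ge0 // addr_ge0.
    by rewrite mulrAC ltr_pdivrMr // ltr_pM2l // ltrD2l ltr1n.
have [N1 h1] := (cvg_seqP _ _).1 ux _ d0.
have [N2 h2] := (cvg_seqP _ _).1 vy _ d0.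
exists (maxn N1 N2) => n; rewrite geq_max => /andP[/h1 a1 /h2 a2].
have -> : inner (u n) (v n) - inner x y =
  inner (u n - x) (v n - y) + inner (u n - x) y + inner x (v n - y).
  by rewrite !innerBl !innerBr; ring.
apply: le_lt_trans hd.
have := ler_normD (inner (u n - x) (v n - y) + inner (u n - x) y) (inner x (v n - y)).
move=> /le_trans; apply.
have := ler_normD (inner (u n - x) (v n - y)) (inner (u n - x) y).
move=> hh; apply: le_trans (lerD hh (lexx _)) _ => {hh}.
have -> : d * (`|x| + `|y| + 1) = d + d * `|y| + `|x| * d by ring.
apply: lerD; last first.
  by apply: le_trans (cauchy_schwarz _ _) _; rewrite ler_wpM2l // ltW.
apply: lerD; apply: le_trans (cauchy_schwarz _ _) _.
  rewrite -[leRHS]mulr1; apply: ler_pM => //; first exact: ltW.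
  by apply: le_trans (ltW a2) _.
by rewrite ler_wpM2r // ltW.
Qed.

(** Equalities of inner products pass to limits; the two sides may live in different
spaces, which is how two representations are compared. *)
Lemma inner_cvg_uniq H K (u v : nat -> H) (u' v' : nat -> K) x y x' y' :
  u n @[n --> \oo] --> x -> v n @[n --> \oo] --> y ->
  u' n @[n --> \oo] --> x' -> v' n @[n --> \oo] --> y' ->
  (forall n, inner (u n) (v n) = inner (u' n) (v' n)) -> inner x y = inner x' y'.
Proof.
move=> ux vy ux' vy' e.
have h := inner_cvg ux vy; have h' := inner_cvg ux' vy'.
rewrite (funext e : (fun n => inner (u n) (v n)) = _) in h.
exact: (@cvg_seq_uniq _ C^o _ _ _ h h').
Qed.

Lemma inner_eq0 H (x : H) : (forall y, inner x y = 0) -> x = 0.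
Proof.
move=> h; apply/eqP; have := h x; rewrite inner_norm => /eqP.
by rewrite expf_eq0 normr_eq0.
Qed.

Lemma inner_inj H (x x' : H) : (forall y, inner x y = inner x' y) -> x = x'.
Proof.
move=> h; apply/eqP; rewrite -subr_eq0; apply/eqP/inner_eq0 => y.
by rewrite innerBl h subrr.
Qed.

Lemma adjoint_uniq H (T T1 T2 : H -> H) :
  is_adjoint T T1 -> is_adjoint T T2 -> T1 = T2.
Proof.
move=> h1 h2; apply/funext => y; apply: inner_inj => x.
by rewrite innerC -h1 h2 -innerC.
Qed.

Lemma norm_inner_eq H K (x : H) (y : K) :
  inner x x = inner y y -> `|x| = `|y|.
Proof.
rewrite !inner_norm => /eqP; rewrite eqrXn2 // => /eqP //.
Qed.

End Hilbert.

Section BoundedOp.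
Context {R : realType} (H K : hilbertType R).
Implicit Types T : H -> K.

Lemma bounded_op_bound T : bounded_op T ->
  exists2 c : R[i], 0 < c & forall x, `|T x| <= c * `|x|.
Proof.
move=> [lT cT].
pose g := GRing.isLinear.Build R[i] H K _ T lT.
pose f : {linear H -> K} := HB.pack T g.
have /linear_boundedP := (@linear_bounded_continuous _ _ _ f).2 cT.
by case/pinfty_ex_gt0 => c c0 h; exists c.
Qed.

Lemma bound_bounded_op T (c : R[i]) : linear T -> 0 <= c ->
  (forall x, `|T x| <= c * `|x|) -> bounded_op T.
Proof.
move=> lT c0 h; split => //.
pose g := GRing.isLinear.Build R[i] H K _ T lT.
pose f : {linear H -> K} := HB.pack T g.
apply: (@linear_bounded_continuous _ _ _ f).1.
apply/linear_boundedP; near=> r => x; apply: le_trans (h x) _.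
rewrite ler_wpM2r //; near: r; apply: nbhs_pinfty_ge; exact: ger0_real.
Unshelve. all: by end_near. Qed.

End BoundedOp.

(** * Closed subspaces as Hilbert spaces *)

Section SubHilbert.
Context {R : realType} (K : hilbertType R) (M : set K).

(** The proof that [M] is a closed subspace is a parameter of the type, so that the
Hilbert space structure can be inferred from the type alone. *)
Definition subhilb (hM : closed_subspace M) := {x : K | `[< M x >]}.

Variable hM : closed_subspace M.
Local Notation T := (subhilb hM).

HB.instance Definition _ := SubType.on T.
HB.instance Definition _ := [Choice of T by <:].

Lemma subhilb_submod_closed : submod_closed (fun x : K => `[< M x >]).
Proof.
case: hM => M0 ML _; split; first exact/asboolP.
by move=> c x y /asboolP Mx /asboolP My; apply/asboolP; exact: ML.
Qed.

HB.instance Definition _ :=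
  GRing.SubChoice_isSubLmodule.Build R[i] K _ T subhilb_submod_closed.

Lemma subhilb_val_linear c (x y : T) : val (c *: x + y) = c *: val x + val y.
Proof. exact: linearP. Qed.

Let nrm (x : T) : R[i] := `|val x|.

Let nrmD (x y : T) : nrm (x + y) <= nrm x + nrm y.
Proof. by rewrite /nrm raddfD ler_normD. Qed.

Let nrmZ (c : R[i]) (x : T) : nrm (c *: x) = `|c| * nrm x.
Proof. by rewrite /nrm linearZ normrZ. Qed.

Let nrm0 (x : T) : nrm x = 0 -> x = 0.
Proof. by move=> /eqP; rewrite normr_eq0 => /eqP x0; apply: val_inj; rewrite x0 raddf0. Qed.

HB.instance Definition _ := @Lmodule_isNormed.Build R[i] T nrm nrmD nrmZ nrm0.

Lemma subhilb_normE (x : T) : `|x| = `|val x|. Proof. by []. Qed.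

Lemma subhilb_valP (x : T) : M (val x).
Proof. exact: asboolW (valP x). Qed.

Lemma subhilb_subP (x : K) : M x -> exists y : T, val y = x.
Proof. by move=> /asboolP Mx; exists (exist _ x Mx). Qed.

Lemma subhilb_complete (F : set_system T) : ProperFilter F -> cauchy F -> cvg F.
Proof.
move=> FF /cauchy_ballP Fc.
have : cvg ((val : T -> K) @ F).
  apply: cauchy_cvg; apply: cauchy_exP => e e0.
  have /nearP_dep h := Fc _ e0.
  near F => x; exists (val x); rewrite /nbhs /=.
  have hx : \forall y \near F, ball x e y by near: x.
  apply: filterS hx => y; rewrite -!ball_normE /= subhilb_normE.
  by rewrite raddfB.
move=> /cvg_ex [l hl].
have [_ _ cM] := hM.
have Ml : M l.
  apply: (@closed_cvg _ _ F _ (val : T -> K) M cM _ l hl).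
  by apply: nearW; exact: subhilb_valP.
have [y ly] := subhilb_subP Ml.
apply/cvg_ex; exists y; apply/cvgrPdist_lt => e e0.
move/cvgrPdist_lt: hl => /(_ e e0); apply: filterS => z.
by rewrite subhilb_normE raddfB -ly.
Unshelve. all: by end_near. Qed.

HB.instance Definition _ := Uniform_isComplete.Build T subhilb_complete.

Let inn (x y : T) : R[i] := inner (val x) (val y).

Let inn_bilinear : bilinear_for
  (GRing.Scale.Law.clone _ _ ( *%R ) _)
  (GRing.Scale.Law.clone _ _ ((Num.conj : R[i] -> R[i]) \; *%R) _) inn.
Proof.
split=> [u|u] c x y; rewrite /inn subhilb_val_linear.
  by rewrite innerDl innerZl.
by rewrite innerDr innerZr.
Qed.

Let inn_herm (x y : T) : inn x y = (-1) ^+ false * Num.conj (inn y x).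
Proof. by rewrite expr0 mul1r /inn innerC. Qed.

Let inn_pos (x : T) : x != 0 -> 0 < inn x x.
Proof. by move=> x0; rewrite /inn inner_norm exprn_gt0 // normr_gt0. Qed.

HB.instance Definition _ :=
  bilinear_isBilinear.Build R[i] T T R[i] _ _ inn inn_bilinear.
HB.instance Definition _ :=
  isHermitianSesquilinear.Build R[i] T false Num.conj inn inn_herm.
HB.instance Definition _ := isDotProduct.Build R[i] T inn inn_pos.

Let inn_norm (x : T) : `|x| ^+ 2 = inn x x.
Proof. by rewrite subhilb_normE sqr_norm_inner. Qed.

HB.instance Definition _ := isHilbert.Build R T inn_norm.

Lemma subhilb_innerE (x y : T) : inner x y = inner (val x) (val y).
Proof. by []. Qed.

Lemma subhilb_cvg (u : nat -> T) (x : T) :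
  u n @[n --> \oo] --> x <-> val (u n) @[n --> \oo] --> val x.
Proof.
split=> /cvg_seqP h; apply/cvg_seqP => e /h [N hN]; exists N => n /hN.
  by rewrite subhilb_normE raddfB.
by rewrite subhilb_normE raddfB.
Qed.

End SubHilbert.

(** * Square roots and the automatic boundedness of representations *)

Section Star.
Context {R : realType} (A : cstarType R).
Implicit Types (a b x y : A).

Lemma starD x y : star (x + y) = star x + star y.
Proof. by have := star_antilinear 1 x y; rewrite rmorph1 !scale1r. Qed.

Lemma star0 : star (0 : A) = 0.
Proof. by have := starD 0 0; rewrite addr0 => /esym/eqP; rewrite -subr_eq0 addrK => /eqP. Qed.

Lemma starZ (c : R[i]) x : star (c *: x) = Num.conj c *: star x.
Proof. by have := star_antilinear c x 0; rewrite !addr0 star0 addr0. Qed.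

Lemma starN x : star (- x) = - star x.
Proof. by rewrite -scaleN1r starZ rmorphN1 scaleN1r. Qed.

Lemma starB x y : star (x - y) = star x - star y.
Proof. by rewrite starD starN. Qed.

Lemma star1 : star (1 : A) = 1.
Proof. by have := starM (star 1 : A) 1; rewrite mulr1 starK mulr1. Qed.

End Star.

Section RepresentationBasics.
Context {R : realType} (A : cstarType R) (K : hilbertType R) (rho : A -> K -> K).
Hypothesis hrho : representation rho.
Implicit Types (a b : A) (x y : K).

Lemma repD a b x : rho (a + b) x = rho a x + rho b x.
Proof. by have := rep_linear hrho 1 a b x; rewrite !scale1r. Qed.
Lemma rep0 x : rho 0 x = 0.
Proof. by have := repD 0 0 x; rewrite addr0 => /esym/eqP; rewrite -subr_eq0 addrK => /eqP. Qed.
Lemma repZ c a x : rho (c *: a) x = c *: rho a x.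
Proof. by have := rep_linear hrho c a 0 x; rewrite !addr0 rep0 addr0. Qed.
Lemma repN a x : rho (- a) x = - rho a x.
Proof. by rewrite -scaleN1r repZ scaleN1r. Qed.
Lemma repB a b x : rho (a - b) x = rho a x - rho b x.
Proof. by rewrite repD repN. Qed.

Lemma rep_vecP a c x y : rho a (c *: x + y) = c *: rho a x + rho a y.
Proof. exact: (rep_bounded hrho a).1. Qed.
Lemma rep_vecD a x y : rho a (x + y) = rho a x + rho a y.
Proof. by have := rep_vecP a 1 x y; rewrite !scale1r. Qed.
Lemma rep_vec0 a : rho a 0 = 0.
Proof. by have := rep_vecD a 0 0; rewrite addr0 => /esym/eqP; rewrite -subr_eq0 addrK => /eqP. Qed.
Lemma rep_vecZ a c x : rho a (c *: x) = c *: rho a x.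
Proof. by have := rep_vecP a c x 0; rewrite !addr0 rep_vec0 addr0. Qed.
Lemma rep_vecN a x : rho a (- x) = - rho a x.
Proof. by rewrite -scaleN1r rep_vecZ scaleN1r. Qed.
Lemma rep_vecB a x y : rho a (x - y) = rho a x - rho a y.
Proof. by rewrite rep_vecD rep_vecN. Qed.

Lemma rep_innerl a x y : inner (rho a x) y = inner x (rho (star a) y).
Proof. exact: rep_star hrho a x y. Qed.
Lemma rep_innerr a x y : inner x (rho a y) = inner (rho (star a) x) y.
Proof. by rewrite rep_innerl starK. Qed.

Lemma rep_cvg a (u : nat -> K) x :
  u n @[n --> \oo] --> x -> rho a (u n) @[n --> \oo] --> rho a x.
Proof. by move=> h; exact: (cvg_comp _ _ h ((rep_bounded hrho a).2 x)). Qed.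

(** For a projection, [`|rho a x| ^+ 2 = inner (rho a x) x], and the Cauchy-Schwarz
inequality concludes without any bound on the operator [rho a]. *)
Lemma rep_proj_norm a x : star a * a = a -> `|rho a x| <= `|x|.
Proof.
move=> pa; have sa : star a = a by rewrite -pa starM starK.
have : inner (rho a x) (rho a x) = inner (rho a x) x.
  by rewrite rep_innerr -(rep_mul hrho) pa.
move=> h; have : `|rho a x| ^+ 2 <= `|rho a x| * `|x|.
  rewrite -inner_norm h; apply: le_trans _ (cauchy_schwarz _ _).
  by rewrite ger0_norm // -h inner_norm exprn_ge0.
have [-> _|n0] := eqVneq `|rho a x| 0; first by [].
by rewrite expr2 ler_pM2l // normr_gt0 -normr_eq0.
Qed.

End RepresentationBasics.

(** A complete norm on the *-algebra [A], given by the relation [Bd a c] that the norm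
of [a] is at most [c]. It has two uses: the norm [cnorm], and the operator norm of a
faithful concrete algebra, which the relation describes without a supremum. *)
Record norm_bound {R : realType} (A : cstarType R) (Bd : A -> R -> Prop) : Prop := {
  bd_le : forall x c d, Bd x c -> c <= d -> Bd x d ;
  bdD : forall x y c d, Bd x c -> Bd y d -> Bd (x + y) (c + d) ;
  bdM : forall x y c d, 0 <= c -> 0 <= d -> Bd x c -> Bd y d -> Bd (x * y) (c * d) ;
  bdZ : forall x (t c : R), 0 <= t -> Bd x c -> Bd (t%:C *: x) (t * c) ;
  bdN : forall x c, Bd x c -> Bd (- x) c ;
  bdS : forall x c, Bd x c -> Bd (star x) c ;
  bd0 : Bd 0 0 ;
  bd_sep : forall x, (forall e, 0 < e -> Bd x e) -> x = 0 ;
  bd_complete : forall u : nat -> A,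
    (forall e, 0 < e -> exists N, forall m n, (N <= m)%N -> (N <= n)%N ->
       Bd (u m - u n) e) ->
    exists l, forall e, 0 < e -> exists N, forall n, (N <= n)%N -> Bd (u n - l) e }.

Section SquareRoot.
Context {R : realType} (A : cstarType R) (Bd : A -> R -> Prop).
Hypothesis hBd : norm_bound Bd.

(** The equation for [b] reads [b = (h + b ^+ 2) / 2]. On the selfadjoint elements of norm
at most [s] the right-hand side is a contraction of ratio [s], so iteration from [0]
converges. *)
Lemma one_sub_selfadjoint_square (h : A) (s : R) :
  0 <= s -> s < 1 -> Bd h s -> star h = h ->
  exists2 b, star b = b & (1 - b) * (1 - b) = 1 - h.
Proof.
move=> s0 s1 hs sh.
have half0 : 0 <= (2^-1 : R) by rewrite invr_ge0.
pose half : R[i] := (2^-1)%:C.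
have half2 (x : A) : half *: x + half *: x = x.
  rewrite -scalerDl /half -rmorphD /= -{2}[x]scale1r; congr (_ *: _).
  by rewrite -[RHS](rmorph1 (@real_complex R)); congr (_%:C); lra.
have starH (x : A) : star (half *: x) = half *: star x.
  by rewrite starZ; congr (_ *: _); apply: conj_Creal; rewrite complex_real.
pose b := fix b n : A := if n is m.+1 then half *: (h + b m * b m) else 0.
have bS n : b n.+1 = half *: (h + b n * b n) by [].
have bs n : Bd (b n) s.
  elim: n => [|n IH]; first exact: bd_le hBd _ _ _ (bd0 hBd) s0.
  rewrite bS; apply: (bd_le hBd) (bdZ hBd half0 (bdD hBd hs (bdM hBd s0 s0 IH IH))) _.
  have : s * s <= s * 1 by apply: ler_wpM2l => //; exact: ltW.
  lra.
have bstar n : star (b n) = b n.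
  elim: n => [|n IH]; first exact: star0.
  by rewrite bS starH starD starM IH sh.
have sqB (x y : A) : x * x - y * y = x * (x - y) + (x - y) * y.
  by rewrite mulrBr mulrBl addrA subrK.
have step n : Bd (b n.+1 - b n) (s ^+ n).
  elim: n => [|n IH].
    rewrite expr0 bS subr0 /= mul0r addr0.
    by apply: (bd_le hBd) (bdZ hBd half0 hs) _; lra.
  rewrite {1}bS {2}bS -scalerBr opprD addrACA subrr add0r sqB.
  have sn : 0 <= s ^+ n by exact: exprn_ge0.
  apply: (bd_le hBd) (bdZ hBd half0
    (bdD hBd (bdM hBd s0 sn (bs _) IH) (bdM hBd sn s0 IH (bs _)))) _.
  by rewrite exprS; lra.
have tail n k : Bd (b (n + k)%N - b n) (s ^+ n * (1 - s ^+ k) / (1 - s)).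
  elim: k => [|k IH].
    by rewrite addn0 subrr expr0 subrr mulr0 mul0r; exact: bd0 hBd.
  rewrite addnS -(subrK (b (n + k)%N) (b (n + k).+1)) -addrA.
  apply: (bd_le hBd) (bdD hBd (step _) IH) _.
  rewrite exprD exprS le_eqVlt; apply/orP; left; apply/eqP.
  by field; lra.
have tail' n m : (n <= m)%N -> Bd (b m - b n) (s ^+ n / (1 - s)).
  move=> nm; rewrite -(subnKC nm); apply: (bd_le hBd) (tail _ _) _.
  have s1' : 0 < 1 - s by lra.
  rewrite ler_pM2r ?invr_gt0 // -[leRHS]mulr1 ler_wpM2l ?exprn_ge0 //.
  by rewrite lerBlDr lerDl exprn_ge0.
have small e : 0 < e -> exists N, forall n, (N <= n)%N -> s ^+ n / (1 - s) < e.
  move=> e0; have sn : s ^+ n @[n --> \oo] --> (0 : R).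
    by apply: cvg_expr; rewrite ger0_norm.
  have e1 : 0 < e * (1 - s) by rewrite mulr_gt0 //; lra.
  have /cvgrPdist_lt /(_ _ e1) [N _ NP] := sn.
  exists N => n Nn; rewrite ltr_pdivrMr; last lra.
  have := NP n Nn; rewrite /= sub0r normrN ger0_norm //; exact: exprn_ge0.
have [l hl] : exists l, forall e, 0 < e ->
    exists N, forall n, (N <= n)%N -> Bd (b n - l) e.
  apply: (bd_complete hBd) => e e0; have [N NP] := small _ e0.
  exists N => m n Nm Nn; have [nm|/ltnW mn] := leqP n m.
    by apply: (bd_le hBd) (tail' _ _ nm) _; apply/ltW/NP.
  rewrite -opprB; apply: (bdN hBd).
  by apply: (bd_le hBd) (tail' _ _ mn) _; apply/ltW/NP.
exists l.
  apply/eqP; rewrite -subr_eq0; apply/eqP/(bd_sep hBd) => e e0.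
  have e2 : 0 < e / 2 by lra.
  have [N NP] := hl _ e2; have bN := NP N (leqnn N).
  have := bdS hBd bN; rewrite starB bstar => bN'.
  have -> : star l - l = (b N - l) - (b N - star l).
    by rewrite opprB [RHS]addrC subrKA.
  by apply: (bd_le hBd) (bdD hBd bN (bdN hBd bN')) _; lra.
have lfix : l = half *: (h + l * l).
  apply/eqP; rewrite -subr_eq0; apply/eqP/(bd_sep hBd) => e e0.
  have d0 : 0 < Num.min 1 (e / 4) by rewrite lt_min ltr01 /=; lra.
  set d := Num.min _ _ in d0.
  have [d1 d4] : d <= 1 /\ d <= e / 4 by rewrite /d !ge_min !lexx orbT.
  have [N NP] := hl _ d0; have bN := NP N (leqnn N).
  have bN1 := NP N.+1 (leqnSn N).
  have dge : 0 <= d by exact: ltW.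
  have lb : Bd l (1 + 1).
    have -> : l = b N - (b N - l) by rewrite opprB addrC subrK.
    by apply: (bd_le hBd) (bdD hBd (bs N) (bdN hBd bN)) _; lra.
  have -> : l - half *: (h + l * l) = - (b N.+1 - l) + half *:
      (b N * (b N - l) + (b N - l) * l).
    rewrite -sqB bS !scalerDr !scalerN !opprB -[RHS]addrA; congr (_ + _).
    by rewrite !opprD -[RHS]addrA addKr.
  have two0 : 0 <= 1 + 1 :> R by lra.
  apply: (bd_le hBd) (bdD hBd (bdN hBd bN1) (bdZ hBd half0
    (bdD hBd (bdM hBd s0 dge (bs N) bN) (bdM hBd dge two0 bN lb)))) _.
  have : s * d <= 1 * d by apply: ler_wpM2r => //; exact: ltW.
  lra.
rewrite mulrBr mulr1 mulrBl mul1r.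
have -> : h = l + l - l * l.
  by rewrite {1 2}lfix half2 addrK.
by rewrite !opprB -addrA; congr (_ + _); rewrite addrCA opprD.
Qed.

(** For [a] of norm less than [1] the element [1 - star a * a] is a square [b ^+ 2] with [b]
selfadjoint, so [rho] maps it to a positive operator. The factor [2] comes from
rescaling [a] to norm [1 / 2] and is harmless below. *)
Lemma rep_bound (K : hilbertType R) (rho : A -> K -> K) (a : A) (c : R) (x : K) :
  representation rho -> 0 < c -> Bd a c -> `|rho a x| <= (2 * c)%:C * `|x|.
Proof.
move=> hrho c0 ac; pose t := (2 * c)^-1; have t0 : 0 < t by rewrite invr_gt0; lra.
pose a' := t%:C *: a.
have tc : t * c = 2^-1 by rewrite /t; field; lra.
have ha' : Bd a' (2^-1) by rewrite -tc; apply: bdZ hBd _ _ _ (ltW t0) ac.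
have h0 : 0 <= (2^-1 : R) by lra.
have hh : Bd (star a' * a') (4^-1).
  by apply: (bd_le hBd) (bdM hBd h0 h0 (bdS hBd ha') ha') _; lra.
have q0 : 0 <= (4^-1 : R) by lra.
have q1 : 4^-1 < (1 : R) by lra.
have sh : star (star a' * a') = star a' * a' by rewrite starM starK.
have [b sb bb] := one_sub_selfadjoint_square q0 q1 hh sh.
have : `|rho a' x| <= `|x|.
  apply: le_trans (rep_proj_norm hrho x (_ : star 1 * 1 = 1)); last first.
    by rewrite star1 mulr1.
  rewrite -ler_sqr ?nnegrE // -!inner_norm -subr_ge0.
  have -> : inner (rho 1 x) (rho 1 x) - inner (rho a' x) (rho a' x) =
    inner (rho (1 - b) x) (rho (1 - b) x).
    rewrite [inner (rho (1 - b) x) _]rep_innerl // -(rep_mul hrho) starB sb star1.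
    rewrite [inner (rho a' x) _]rep_innerl // -(rep_mul hrho).
    rewrite [inner (rho 1 x) _]rep_innerl // -(rep_mul hrho) star1 mulr1.
    by rewrite bb (repB hrho) innerBr.
  by rewrite inner_norm exprn_ge0.
have tC : 0 < t%:C by rewrite ltcR.
have -> : (2 * c)%:C = (t%:C)^-1 by rewrite -fmorphV /= invrK.
by rewrite /a' (repZ hrho) normrZ (gtr0_norm tC) ler_pdivlMl.
Qed.

End SquareRoot.

Section CnormBound.
Context {R : realType} (A : cstarType R).
Implicit Types x y : A.

Lemma cnorm0 : cnorm (0 : A) = 0.
Proof.
have := cnormZ 0 (0 : A); rewrite scale0r normr0 mul0r => /eqP.
by rewrite eq_complex => /andP[/eqP].
Qed.

Lemma cnormN x : cnorm (- x) = cnorm x.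
Proof.
have := cnormZ (-1) x; rewrite scaleN1r normrN1 mul1r => /eqP.
by rewrite eq_complex => /andP[/eqP].
Qed.

Lemma cnorm_ge0 x : 0 <= cnorm x.
Proof.
have := cnormD x (- x); rewrite subrr cnorm0 cnormN => h; lra.
Qed.

Lemma cnormB x y : cnorm (x - y) = cnorm (y - x).
Proof. by rewrite -cnormN opprB. Qed.

(** The C*-identity gives [cnorm x ^+ 2 <= cnorm (star x) * cnorm x]. *)
Lemma cnorm_star x : cnorm (star x) = cnorm x.
Proof.
suff h y : cnorm y <= cnorm (star y).
  by apply/eqP; rewrite eq_le h andbT -{2}(starK x) h.
have [y0|y0] := eqVneq (cnorm y) 0; first by rewrite y0 cnorm_ge0.
have := cnormM (star y) y; rewrite cstar_identity expr2 ler_pM2r //.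
by rewrite lt0r y0 cnorm_ge0.
Qed.

Lemma cnormZr (t : R) x : 0 <= t -> cnorm (t%:C *: x) = t * cnorm x.
Proof.
move=> t0; have := cnormZ t%:C x; rewrite ger0_norm ?lecR // -rmorphM /= => /eqP.
by rewrite eq_complex => /andP[/eqP].
Qed.

Lemma cnorm_bound : norm_bound (fun (x : A) c => cnorm x <= c).
Proof.
split.
- by move=> x c d; apply: le_trans.
- by move=> x y c d xc yd; apply: le_trans (cnormD _ _) (lerD xc yd).
- move=> x y c d c0 d0 xc yd; apply: le_trans (cnormM _ _) _.
  by apply: ler_pM => //; exact: cnorm_ge0.
- by move=> x t c t0 xc; rewrite cnormZr // ler_wpM2l.
- by move=> x c; rewrite cnormN.
- by move=> x c; rewrite cnorm_star.
- by rewrite cnorm0.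
- move=> x h; apply: cnorm0_eq0; apply/eqP; rewrite eq_le cnorm_ge0 andbT.
  apply/ler_addgt0Pl => e e0; rewrite addr0; exact: h.
- move=> u hu; have [|l hl] := @cnorm_complete _ _ u.
    move=> e e0; have e2 : 0 < e / 2 by lra.
    have [N NP] := hu _ e2; exists N => m n Nm Nn.
    by have := NP m n Nm Nn; lra.
  exists l => e e0; have /cvgrPdist_lt /(_ _ e0) [N _ NP] := hl.
  exists N => n Nn; have := NP n Nn; rewrite /= sub0r normrN ger0_norm ?cnorm_ge0 //.
  exact: ltW.
Qed.

End CnormBound.

(** * Matrix computations in the CAR algebra *)

Section ElemTensor.
Context {R : realType}.
Local Notation adj M := (map_mx (Num.conj : R[i] -> R[i]) M^T).
Implicit Types (a b : nat -> 'M[R[i]]_2).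

Lemma eq_elem_tensor a b n :
  (forall k, (k < n)%N -> a k = b k) -> elem_tensor a n = elem_tensor b n.
Proof.
elim: n => //= n IH h; rewrite IH ?h // => k kn; apply: h; exact: ltnW.
Qed.

Lemma tensmx11 m n : (1%:M : 'M[R[i]]_m) *t (1%:M : 'M[R[i]]_n) = 1%:M.
Proof.
apply/matrixP => i j.
have [i1 i2] := mxtens_indexP i; have [j1 j2] := mxtens_indexP j.
rewrite tensmxE !mxE (can_eq (@mxtens_indexK _ _)) xpair_eqE.
by case: (i1 == j1); case: (i2 == j2); rewrite ?mulr1 ?mulr0 // mul0r.
Qed.

Lemma elem_tensor1 n : elem_tensor (fun _ => (1%:M : 'M[R[i]]_2)) n = 1%:M.
Proof. by elim: n => //= n ->; rewrite tensmx11. Qed.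

Lemma elem_tensorM a b n :
  elem_tensor a n *m elem_tensor b n = elem_tensor (fun k => a k *m b k) n.
Proof. by elim: n => [|n IH] /=; rewrite ?mulmx1 // tensmx_mul IH. Qed.

Lemma elem_tensor_adj a n :
  adj (elem_tensor a n) = elem_tensor (fun k => adj (a k)) n.
Proof.
elim: n => [|n IH] /=; first by rewrite trmx1 map_mx1.
by rewrite trmx_tens map_mxT IH.
Qed.

Lemma tensmxBr m n (A : 'M[R[i]]_m) (B B' : 'M[R[i]]_n) :
  A *t (B - B') = A *t B - A *t B'.
Proof.
apply/matrixP => i j.
have [i1 i2] := mxtens_indexP i; have [j1 j2] := mxtens_indexP j.
by rewrite [RHS]mxE [X in _ = _ + X]mxE !tensmxE !mxE mulrBr.
Qed.

(** The tensor power of a rank one diagonal projection is again a diagonal matrix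
unit; this makes compression by it scalar. *)
Lemma elem_tensor_corner n :
  exists i, elem_tensor (fun _ => delta_mx 0 0 : 'M[R[i]]_2) n = delta_mx i i.
Proof.
elim: n => [|n [i IH]] /=.
  exists 0; apply/matrixP => i j; rewrite !mxE !ord1 eqxx //.
exists (mxtens_index (i, 0)); rewrite IH; apply/matrixP => k l.
have [k1 k2] := mxtens_indexP k; have [l1 l2] := mxtens_indexP l.
rewrite tensmxE !mxE !(can_eq (@mxtens_indexK _ _)) !xpair_eqE.
by do 4 case: (_ == _); rewrite ?mulr1 ?mulr0 ?mul0r.
Qed.

Lemma delta_compress n (i : 'I_n) (M : 'M[R[i]]_n) :
  delta_mx i i *m M *m delta_mx i i = M i i *: delta_mx i i.
Proof.
apply/matrixP => k l; rewrite !mxE (bigD1 i) //= !mxE (bigD1 i) //= !mxE.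
rewrite !eqxx big1 ?addr0; last first.
  by move=> j ji; rewrite !mxE (negPf ji) andbF mul0r.
rewrite big1 ?addr0; last by move=> j ji; rewrite !mxE (negPf ji) mulr0.
by rewrite andbT; case: (k == i); case: (l == i); rewrite ?mul1r ?mulr1 ?mul0r ?mulr0.
Qed.

End ElemTensor.

Section CarProjections.
Context {R : realType} (C : cstarType R) (iota : forall n, 'M[R[i]]_(cdim n) -> C).
Hypothesis hC : car_algebra iota.
Local Notation q := (car_q iota).

Lemma car_iotaB n M N : iota (n:=n) (M - N) = iota M - iota N.
Proof.
have := car_linear hC (n:=n) (-1) N M.
by rewrite !scaleN1r => h; rewrite addrC h addrC.
Qed.

Lemma car_iotaZ n (c : R[i]) (M : 'M[R[i]]_(cdim n)) : iota (c *: M) = c *: iota M.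
Proof.
have i0 : iota (0 : 'M[R[i]]_(cdim n)) = 0 by rewrite -(subrr 0) car_iotaB subrr.
by have := car_linear hC c M 0; rewrite !addr0 i0 addr0.
Qed.

Lemma car_q0 : q 0 = 1. Proof. exact: car_one hC 0. Qed.

Lemma delta_adj (i j : 'I_2) :
  map_mx (Num.conj : R[i] -> R[i]) (delta_mx i j : 'M[R[i]]_2)^T = delta_mx j i.
Proof. by rewrite trmx_delta map_delta_mx. Qed.

Lemma car_q_star n : star (q n) = q n.
Proof.
rewrite /car_q -(car_star hC) elem_tensor_adj; congr (iota _).
by apply: eq_elem_tensor => k _; rewrite delta_adj.
Qed.

Lemma car_q_idem n : q n * q n = q n.
Proof.
rewrite /car_q -(car_mul hC) elem_tensorM; congr (iota _).
by apply: eq_elem_tensor => k _; rewrite mul_delta_mx.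
Qed.

Lemma car_q_succ n : q n.+1 * q n = q n.+1.
Proof.
rewrite /car_q -[iota (elem_tensor _ n)](car_compat hC) -(car_mul hC) /=.
congr (iota _); rewrite tensmx_mul mulmx1 elem_tensorM; congr (_ *t _).
by apply: eq_elem_tensor => k _; rewrite mul_delta_mx.
Qed.

Lemma car_q_le m n : (n <= m)%N -> q m * q n = q m.
Proof.
move=> /subnKC <-; elim: (m - n)%N => [|k IH]; first by rewrite addn0 car_q_idem.
by rewrite addnS -[LHS]/(q (n + k).+1 * _) -car_q_succ -mulrA IH.
Qed.

Lemma car_q_le' m n : (n <= m)%N -> q n * q m = q m.
Proof. by move=> h; rewrite -(car_q_star n) -(car_q_star m) -starM car_q_le. Qed.

(** The projection [q n] is minimal in the stage [n], which is why vectors fixed by all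
the [q n] see only one state. *)
Lemma car_compress n (M : 'M[R[i]]_(cdim n)) :
  exists mu, q n * iota M * q n = mu *: q n.
Proof.
rewrite /car_q; have [i ->] := elem_tensor_corner (R := R) n.
by exists (M i i); rewrite -!(car_mul hC) delta_compress car_iotaZ.
Qed.

(** The witness is the tensor product of the corner with the off-diagonal matrix unit
of the next factor. It shows that every trace halves from [q n] to [q n.+1]. *)
Lemma car_q_halving n :
  exists v, v * star v = q n.+1 /\ star v * v = q n - q n.+1.
Proof.
pose Q := elem_tensor (fun _ => delta_mx 0 0 : 'M[R[i]]_2) n.
have QQ : Q *m Q = Q.
  rewrite /Q elem_tensorM.
  by apply: eq_elem_tensor => k _; rewrite mul_delta_mx.
have Qa : map_mx (Num.conj : R[i] -> R[i]) Q^T = Q.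
  rewrite /Q elem_tensor_adj.
  by apply: eq_elem_tensor => k _; rewrite delta_adj.
exists (iota (n := n.+1) (Q *t (delta_mx 0 1 : 'M[R[i]]_2))).
rewrite -(car_star hC) trmx_tens map_mxT Qa delta_adj -!(car_mul hC) !tensmx_mul QQ.
rewrite !mul_delta_mx; split => //.
rewrite /car_q -[iota (elem_tensor _ n)](car_compat hC) -car_iotaB /= -/Q.
congr (iota _); rewrite -tensmxBr; congr (_ *t _); apply/matrixP => i j; rewrite !mxE.
case: i => [] [|[|i]] // hi; case: j => [] [|[|j]] // hj;
  by rewrite -!val_eqE /= ?subr0 ?subrr.
Qed.

Lemma car_approx (b : C) : exists2 u : nat -> C,
  (forall k, exists n (M : 'M[R[i]]_(cdim n)), u k = iota M) &
  forall e : R, 0 < e -> exists N, forall k, (N <= k)%N -> cnorm (u k - b) < e.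
Proof.
have h k : exists u, (exists n (M : 'M[R[i]]_(cdim n)), u = iota M) /\
    cnorm (u - b) < k.+1%:R^-1.
  have e0 : 0 < k.+1%:R^-1 :> R by rewrite invr_gt0.
  have [n [M hM]] := car_dense hC b e0; exists (iota M).
  by rewrite cnormB; split => //; exists n, M.
have [u hu] := choice h; exists u; first by move=> k; exact: (hu k).1.
move=> e /inv_succ_small [N hN]; exists N => k /hN.
exact: lt_trans (hu k).2.
Qed.

End CarProjections.

(** * Vectors excising the state of the projections $q_n$ *)

Section HilbertSequences.
Context {R : realType} (K : hilbertType R).
Implicit Types (v : nat -> K) (x y : K).

Lemma cauchy_seq_cvg v :
  (forall e : R[i], 0 < e -> exists N, forall m n, (N <= m)%N -> (N <= n)%N ->
     `|v m - v n| < e) ->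
  exists l : K, v n @[n --> \oo] --> l.
Proof.
move=> hv; suff /cvg_ex [l hl] : cvg (v @ \oo) by exists l.
apply: cauchy_cvg; apply: cauchy_exP => e e0; have [N hN] := hv _ e0.
exists (v N); exists N => // n /= Nn; rewrite -ball_normE /=; exact: hN.
Qed.

(** The sequence [r] is nonincreasing and bounded below, hence Cauchy. *)
Lemma cvg_telescoping v (r : nat -> R[i]) :
  (forall n, 0 <= r n) ->
  (forall m n, (n <= m)%N -> `|v m - v n| ^+ 2 = r n - r m) ->
  exists l : K, v n @[n --> \oo] --> l.
Proof.
move=> r0 hr.
pose t n := complex.Re (r n).
have rt n : r n = (t n)%:C by have [a _ ar] := ge0_realC (r0 n); rewrite /t -ar.
have t0 n : 0 <= t n by rewrite -lecR -rt.
have tle m n : (n <= m)%N -> t m <= t n.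
  by move=> nm; rewrite -subr_ge0 -lecR rmorphB /= -!rt -hr // exprn_ge0.
have /cvg_ex [l /cvgrPdist_lt tl] : cvgn t.
  apply: nonincreasing_is_cvgn; first by move=> m n; exact: tle.
  by exists 0 => _ [n _ <-].
apply: cauchy_seq_cvg => e e0.
have [d d0 de] := gt0_realC (exprn_gt0 2 e0).
have d2 : 0 < d / 2 by lra.
have [N _ hN] := tl _ d2.
have main m n : (N <= n)%N -> (n <= m)%N -> `|v m - v n| < e.
  move=> Nn nm; rewrite -ltr_sqr ?nnegrE ?(ltW e0) // hr // -de !rt -rmorphB ltcR.
  have := hN _ Nn; have := hN _ (leq_trans Nn nm).
  by rewrite /= !ltr_norml => /andP[? ?] /andP[? ?]; lra.
exists N => m n Nm Nn; have [nm|/ltnW mn] := leqP n m; first exact: main.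
by rewrite distrC; exact: main.
Qed.

Lemma orth_dense (T : Type) (f : T -> K) x :
  closure (range f) = setT -> (forall a, inner x (f a) = 0) -> x = 0.
Proof.
move=> cl h; apply/eqP; apply/negPn/negP; rewrite -normr_gt0 => x0.
(* A vector of the range at distance less than [`|x|] from [x] is not orthogonal to [x]. *)
have [a ha] : exists a, `|f a - x| < `|x| by apply: density_dist; rewrite ?cl.
have : `|x| ^+ 2 < `|x| ^+ 2.
  rewrite -{1}inner_norm -{2}(subrK (f a) x) innerDr h addr0.
  have hh : 0 <= inner x (x - f a).
    have -> : inner x (x - f a) = inner x x by rewrite innerBr h subr0.
    by rewrite inner_norm exprn_ge0.
  rewrite -(ger0_norm hh); apply: le_lt_trans (cauchy_schwarz _ _) _.
  by rewrite expr2 ltr_pM2l // distrC.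
by rewrite ltxx.
Qed.

End HilbertSequences.

Section BoundedRepresentations.
Context {R : realType} (A : cstarType R) (Bd : A -> R -> Prop).
Hypothesis hBd : norm_bound Bd.
Context (K : hilbertType R) (rho : A -> K -> K).
Hypothesis hrho : representation rho.

Lemma rep_small (x : K) (e : R[i]) : 0 < e ->
  exists2 d, 0 < d & forall a, Bd a d -> `|rho a x| < e.
Proof.
move=> /gt0_realC [{}e e0 <-]; have [n n0 nx] := ge0_realC (normr_ge0 x).
have n1 : 0 < n + 1 by lra.
pose d := e / (2 * (n + 1)).
have d0 : 0 < d by rewrite divr_gt0 // mulr_gt0.
exists d => // a ad; apply: le_lt_trans (rep_bound hBd x hrho d0 ad) _.
rewrite -nx -rmorphM ltcR.
have -> : 2 * d = e / (n + 1) by rewrite /d; field; lra.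
by rewrite mulrAC ltr_pdivrMr // ltr_pM2l //; lra.
Qed.

(** Strong continuity of a representation in its algebra variable. *)
Lemma rep_approx (u : nat -> A) a (x : K) :
  (forall e : R, 0 < e -> exists N, forall n, (N <= n)%N -> Bd (u n - a) e) ->
  rho (u n) x @[n --> \oo] --> rho a x.
Proof.
move=> hu; apply/cvg_seqP => e e0; have [d d0 hd] := rep_small x e0.
have [N hN] := hu _ d0; exists N => n Nn; rewrite -(repB hrho); exact/hd/hN.
Qed.

End BoundedRepresentations.

Section CarRepresentations.
Context {R : realType} (C : cstarType R) (iota : forall n, 'M[R[i]]_(cdim n) -> C).
Hypothesis hC : car_algebra iota.
Local Notation q := (car_q iota).

(** For [x] of norm [1] this says that [x] has as vector state the product state selecting
the first coordinates; [0] is included. *)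
Definition car_fixed (K : hilbertType R) (sigma : C -> K -> K) (x : K) : Prop :=
  forall n, sigma (q n) x = x.

Lemma car_dense_rep (b : C) : exists2 u : nat -> C,
  (forall k, exists n (M : 'M[R[i]]_(cdim n)), u k = iota M) &
  forall (K : hilbertType R) (sigma : C -> K -> K) x, representation sigma ->
    sigma (u k) x @[k --> \oo] --> sigma b x.
Proof.
have [u hu hub] := car_approx hC b; exists u => // K sigma x hs.
apply: (rep_approx (cnorm_bound C) hs) => e e0.
by have [N hN] := hub _ e0; exists N => n /hN /ltW.
Qed.

(** The scalar depends on [M] only, neither on the representation nor on the vectors.
All the statements on fixed vectors below come from this by density. *)
Lemma car_fixed_coef n (M : 'M[R[i]]_(cdim n)) : exists mu : R[i],
  forall (K : hilbertType R) (sigma : C -> K -> K) x y, representation sigma ->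
    car_fixed sigma x -> car_fixed sigma y ->
    inner (sigma (iota M) x) y = mu * inner x y.
Proof.
have [mu hmu] := car_compress hC M; exists mu => K sigma x y hs hx hy.
rewrite -{1}(hx n) -{1}(hy n) (rep_innerr hs) (car_q_star hC).
by rewrite -!(rep_mul hs) hmu (repZ hs) hx innerZl.
Qed.

Lemma car_fixed_state (K1 K2 : hilbertType R) (s1 : C -> K1 -> K1)
    (s2 : C -> K2 -> K2) x1 x2 b :
  representation s1 -> representation s2 -> car_fixed s1 x1 -> car_fixed s2 x2 ->
  inner x1 x1 = inner x2 x2 -> inner (s1 b x1) x1 = inner (s2 b x2) x2.
Proof.
move=> h1 h2 f1 f2 e12; have [u hu hub] := car_dense_rep b.
apply: (inner_cvg_uniq (hub _ _ x1 h1) (cvg_cst x1) (hub _ _ x2 h2) (cvg_cst x2)).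
move=> k; have [n [M ->]] := hu k; have [mu hmu] := car_fixed_coef M.
by rewrite !hmu // e12.
Qed.

(** The strong limit of a decreasing sequence of projections is the projection on the
common range. *)
Lemma car_q_cvg (K : hilbertType R) (sigma : C -> K -> K) x :
  representation sigma ->
  exists2 y, sigma (q n) x @[n --> \oo] --> y & car_fixed sigma y.
Proof.
move=> hs.
have [|m n nm|y hy] := @cvg_telescoping _ _ (fun n => sigma (q n) x)
    (fun n => `|sigma (q n) x| ^+ 2).
- by move=> n; rewrite exprn_ge0.
- rewrite -!inner_norm -(repB hs) (rep_innerr hs) -(rep_mul hs).
  rewrite !(rep_innerr hs) -!(rep_mul hs) starB !(car_q_star hC).
  rewrite mulrBl !mulrBr !(car_q_idem hC) (car_q_le hC nm) (car_q_le' hC nm).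
  by rewrite subrr add0r opprB (repB hs) innerBl.
exists y => // k; apply: (cvg_seq_uniq _ hy).
have h := rep_cvg (a := q k) hs hy.
apply: cvg_trans h; apply: near_eq_cvg; exists k => // n /= kn.
by rewrite -(rep_mul hs) (car_q_le' hC kn).
Qed.

(** The part of [x] orthogonal to [xi] is orthogonal to the whole orbit of [xi], because
the coefficients between fixed vectors are multiples of their inner product. *)
Lemma car_fixed_cyclic (K : hilbertType R) (sigma : C -> K -> K) (xi x : K) :
  representation sigma -> closure (range (fun a => sigma a xi)) = setT ->
  car_fixed sigma xi -> car_fixed sigma x -> inner xi xi = 1 ->
  x = inner x xi *: xi.
Proof.
move=> hs cl hxi hx nxi; apply/eqP; rewrite -subr_eq0; apply/eqP.
set x' := x - _.
have hx' : car_fixed sigma x'.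
  by move=> n; rewrite /x' (rep_vecB hs) (rep_vecZ hs) hx hxi.
have x'xi : inner x' xi = 0 by rewrite innerBl innerZl nxi mulr1 subrr.
apply: orth_dense cl _ => b; rewrite (rep_innerr hs).
have [u hu hub] := car_dense_rep (star b).
rewrite -[RHS](inner0r (0 : K)).
apply: (inner_cvg_uniq (hub _ _ x' hs) (cvg_cst xi) (cvg_cst 0) (cvg_cst 0)).
move=> k; have [n [M ->]] := hu k; have [mu hmu] := car_fixed_coef M.
by rewrite hmu // x'xi mulr0 inner0r.
Qed.

End CarRepresentations.

(** * Cyclic vectors and intertwining operators *)

Section Intertwining.
Context {R : realType}.

Lemma closure_seq (K : hilbertType R) (T : Type) (f : T -> K) (y : K) :
  closure (range f) y -> exists a : nat -> T, f (a n) @[n --> \oo] --> y.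
Proof.
move=> cl; have h n : exists a, `|f a - y| < (n.+1%:R^-1 : R[i]).
  by apply: density_dist => //; rewrite invr_gt0 ltr0n.
have [a ha] := choice h; exists a; apply/cvg_seqP => e e0.
have [d d0 de] := gt0_realC e0; have [N hN] := inv_succ_small d0.
exists N => n Nn; apply: lt_trans (ha n) _.
by rewrite -de -(rmorph_nat (@real_complex R)) -fmorphV /= ltcR; exact: hN.
Qed.

Lemma closed_from_seq (K : hilbertType R) (M : set K) :
  (forall (u : nat -> K) l, (forall n, M (u n)) -> u n @[n --> \oo] --> l -> M l) ->
  closed M.
Proof.
move=> h y cly; pose f (w : {w | M w}) := sval w.
have rf : range f = M.
  by apply/seteqP; split => [_ [w _ <-]|w Mw]; [exact: svalP|exists (exist _ w Mw)].
have /closure_seq [a ha] : closure (range f) y by rewrite rf.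
by apply: h ha => n; exact: svalP.
Qed.

Context (A : cstarType R).

Lemma rep_twist (K : hilbertType R) (sigma : A -> K -> K) (alpha : A -> A) :
  linear alpha -> (forall a b, alpha (a * b) = alpha a * alpha b) ->
  (forall a, alpha (star a) = star (alpha a)) ->
  representation sigma -> representation (fun a => sigma (alpha a)).
Proof.
move=> lin mul st hs; split.
- by move=> a; exact: rep_bounded hs _.
- by move=> c a b x; rewrite lin (rep_linear hs).
- by move=> a b x; rewrite mul (rep_mul hs).
- by move=> a; rewrite st; exact: rep_star hs _.
Qed.

Lemma invariant_closure_orbit (K : hilbertType R) (sigma : A -> K -> K) (x : K) :
  representation sigma ->
  invariant_subspace sigma (closure (range (fun a => sigma a x))).
Proof.
move=> hs; have cc := @closed_closure K (range (fun a => sigma a x)).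
split; [split => //|].
- by apply: subset_closure; exists 0 => //; rewrite (rep0 hs).
- move=> c y z /closure_seq [a ha] /closure_seq [b hb].
  apply: (closed_seq (u := fun n => sigma (c *: a n + b n) x) cc).
    by move=> n; apply: subset_closure; exists (c *: a n + b n).
  rewrite (_ : (fun n => _) = fun n => c *: sigma (a n) x + sigma (b n) x).
    by apply: cvgD => //; apply: cvgZr.
  by apply/funext => n; rewrite (rep_linear hs).
- move=> b y /closure_seq [a ha].
  apply: (closed_seq (u := fun n => sigma (b * a n) x) cc).
    by move=> n; apply: subset_closure; exists (b * a n).
  rewrite (_ : (fun n => _) = fun n => sigma b (sigma (a n) x)).
    exact: rep_cvg.
  by apply/funext => n; rewrite (rep_mul hs).
Qed.

(** If the closed orbit of [x] is zero, then [x] is in the subspace killed by the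
representation, which is invariant and proper, hence zero. *)
Lemma irreducible_cyclic (K : hilbertType R) (sigma : A -> K -> K) (x : K) :
  nonzero_irreducible_rep sigma -> x <> 0 ->
  closure (range (fun a => sigma a x)) = setT.
Proof.
move=> [hs [b [y _ hby]] irr] x0.
have inv := invariant_closure_orbit x hs.
have [M0|//] := irr _ inv (@subsetT _ _).
pose N := [set z | forall a, sigma a z = 0].
have [] := irr N _ (@subsetT _ _).
- split; [split|].
  + by move=> a; rewrite (rep_vec0 hs).
  + by move=> c z z' hz hz' a; rewrite (rep_vecP hs) hz hz' scaler0 addr0.
  + apply: closed_from_seq => u l hu ul a.
    apply: (cvg_seq_uniq (rep_cvg (a := a) hs ul)).
    rewrite (_ : (fun n => _) = fun n => 0); first exact: cvg_cst.
    by apply/funext => n; exact: hu.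
  + by move=> a z hz b'; rewrite -(rep_mul hs).
- move=> N0; suff : N x by rewrite N0.
  move=> a; suff : closure (range (fun a => sigma a x)) (sigma a x) by rewrite M0.
  by apply: subset_closure; exists a.
- by move=> NT; have : N y by rewrite NT.
Qed.

Lemma cyclic_rep1 (K : hilbertType R) (sigma : A -> K -> K) (x : K) :
  representation sigma -> closure (range (fun a => sigma a x)) = setT ->
  forall y, sigma 1 y = y.
Proof.
move=> hs cl y; have /closure_seq [a ha] : closure (range (fun a => sigma a x)) y.
  by rewrite cl.
apply: (cvg_seq_uniq _ ha); have := rep_cvg (a := 1) hs ha.
rewrite (_ : (fun n => sigma 1 _) = fun n => sigma (a n) x) //.
by apply/funext => n; rewrite -(rep_mul hs) mul1r.
Qed.

Context (K1 K2 : hilbertType R) (s1 : A -> K1 -> K1) (s2 : A -> K2 -> K2).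
Context (x1 : K1) (x2 : K2).
Hypotheses (h1 : representation s1) (h2 : representation s2).
Hypothesis states : forall a, inner (s1 a x1) x1 = inner (s2 a x2) x2.
Hypothesis cl1 : closure (range (fun a => s1 a x1)) = setT.

(** The graph of the unitary operator that sends [s1 a x1] to [s2 a x2], before it is
known to be a function. Stated as a relation, it is symmetric in the two sides. *)
Definition orbit_related (y : K1) (z : K2) : Prop := exists a : nat -> A,
  s1 (a n) x1 @[n --> \oo] --> y /\ s2 (a n) x2 @[n --> \oo] --> z.

Let orbit_inner a b :
  inner (s1 a x1) (s1 b x1) = inner (s2 a x2) (s2 b x2).
Proof. by rewrite (rep_innerr h1) (rep_innerr h2) -(rep_mul h1) -(rep_mul h2). Qed.

Lemma orbit_related_total y : exists z, orbit_related y z.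
Proof.
have /closure_seq [a ha] : closure (range (fun a => s1 a x1)) y by rewrite cl1.
have [|z hz] := @cauchy_seq_cvg _ _ (fun n => s2 (a n) x2); last by exists z, a.
move=> e e0; have e2 : 0 < e / 2 by rewrite divr_gt0.
have [N hN] := (cvg_seqP _ _).1 ha _ e2; exists N => m n Nm Nn.
have -> : `|s2 (a m) x2 - s2 (a n) x2| = `|s1 (a m) x1 - s1 (a n) x1|.
  by apply: norm_inner_eq; rewrite -(repB h1) -(repB h2) orbit_inner.
have -> : s1 (a m) x1 - s1 (a n) x1 = (s1 (a m) x1 - y) - (s1 (a n) x1 - y).
  by rewrite opprB addrA subrK.
apply: le_lt_trans (ler_normB _ _) _.
by rewrite (splitr e) ltrD // hN.
Qed.

Lemma orbit_related_inner y z y' z' :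
  orbit_related y z -> orbit_related y' z' -> inner y y' = inner z z'.
Proof.
move=> [a [ha1 ha2]] [b [hb1 hb2]]; apply: (inner_cvg_uniq ha1 hb1 ha2 hb2) => n.
exact: orbit_inner.
Qed.

Lemma orbit_related_lin c y z y' z' : orbit_related y z -> orbit_related y' z' ->
  orbit_related (c *: y + y') (c *: z + z').
Proof.
move=> [a [ha1 ha2]] [b [hb1 hb2]]; exists (fun n => c *: a n + b n); split.
  rewrite (_ : (fun n => _) = fun n => c *: s1 (a n) x1 + s1 (b n) x1).
    by apply: cvgD => //; apply: cvgZr.
  by apply/funext => n; rewrite (rep_linear h1).
rewrite (_ : (fun n => _) = fun n => c *: s2 (a n) x2 + s2 (b n) x2).
  by apply: cvgD => //; apply: cvgZr.
by apply/funext => n; rewrite (rep_linear h2).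
Qed.

Lemma orbit_related_uniq y z z' : orbit_related y z -> orbit_related y z' -> z = z'.
Proof.
move=> hz hz'; have h := orbit_related_lin (-1) hz hz'.
have := orbit_related_inner h h; rewrite scaleN1r addNr inner0l inner_norm.
move=> /esym/eqP; rewrite expf_eq0 /= normr_eq0 scaleN1r addrC subr_eq0.
by move=> /eqP.
Qed.

Lemma orbit_related_rep b y z : orbit_related y z -> orbit_related (s1 b y) (s2 b z).
Proof.
move=> [a [ha1 ha2]]; exists (fun n => b * a n); split.
  rewrite (_ : (fun n => _) = fun n => s1 b (s1 (a n) x1)); first exact: rep_cvg.
  by apply/funext => n; rewrite (rep_mul h1).
rewrite (_ : (fun n => _) = fun n => s2 b (s2 (a n) x2)); first exact: rep_cvg.
by apply/funext => n; rewrite (rep_mul h2).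
Qed.

(** The intertwining isometry carries [y] to a vector fixed by the same elements.
Cyclicity is asked of [x1] only: the second representation may be larger. *)
Lemma fixed_vector_transfer (P : set A) (y : K1) : y <> 0 ->
  (forall a, P a -> s1 a y = y) ->
  exists2 z, z <> 0 & forall a, P a -> s2 a z = z.
Proof.
move=> y0 hy; have [z hz] := orbit_related_total y; exists z.
  move=> z0; apply: y0; apply/eqP; rewrite -normr_eq0.
  by rewrite (norm_inner_eq (orbit_related_inner hz hz)) z0 normr0.
move=> a Pa; have := orbit_related_rep a hz; rewrite (hy _ Pa) => hz'.
exact: orbit_related_uniq hz' hz.
Qed.

End Intertwining.

(** The uniqueness part of the GNS construction. *)
Lemma cyclic_equivalent {R : realType} (A : cstarType R) (K1 K2 : hilbertType R)
    (s1 : A -> K1 -> K1) (s2 : A -> K2 -> K2) (x1 : K1) (x2 : K2) :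
  representation s1 -> representation s2 ->
  (forall a, inner (s1 a x1) x1 = inner (s2 a x2) x2) ->
  closure (range (fun a => s1 a x1)) = setT ->
  closure (range (fun a => s2 a x2)) = setT ->
  unitarily_equivalent s1 s2.
Proof.
move=> h1 h2 st cl1 cl2.
have [U hU] := choice (orbit_related_total h1 h2 st cl1).
have uniq := orbit_related_uniq h1 h2 st.
exists U; split.
- by move=> c x y; apply: uniq (hU _) _; exact: orbit_related_lin.
- by move=> x y; rewrite (orbit_related_inner h1 h2 st (hU x) (hU y)).
- move=> y; have [x [a [hx hy]]] := orbit_related_total h2 h1 (fun a => esym (st a)) cl2 y.
  by exists x; apply: uniq (hU _) _; exists a.
- by move=> a x; apply: uniq (hU _) _; exact: orbit_related_rep.
Qed.

(** * Ladders of partial isometries *)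

Section PositiveZero.
Context {R : realType} (C : cstarType R).

Lemma starMl_eq0 (x : C) : star x * x = 0 -> x = 0.
Proof.
move=> h; have := cstar_identity x; rewrite h cnorm0 => /esym/eqP.
by rewrite expf_eq0 /= => /eqP; exact: cnorm0_eq0.
Qed.

End PositiveZero.

(** The partial isometry [w n] has source [P n - P n.+1] and range [Q n - Q n.+1], where [P]
and [Q] decrease from [1]. Exchanging [P] and [Q] and replacing [w n] by its adjoint gives
another ladder, so each fact about sources has a dual about ranges. *)
Record ladder {R : realType} (C : cstarType R) (P Q w : nat -> C) : Prop := {
  ladder_src0 : P 0%N = 1 ;
  ladder_tgt0 : Q 0%N = 1 ;
  ladder_src_star : forall n, star (P n) = P n ;
  ladder_tgt_star : forall n, star (Q n) = Q n ;
  ladder_src_le : forall m n, (n <= m)%N -> P m * P n = P m ;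
  ladder_tgt_le : forall m n, (n <= m)%N -> Q m * Q n = Q m ;
  ladder_src : forall n, star (w n) * w n = P n - P n.+1 ;
  ladder_tgt : forall n, w n * star (w n) = Q n - Q n.+1 }.

Section Ladder.
Context {R : realType} (C : cstarType R).

Lemma ladder_dual (P Q w : nat -> C) :
  ladder P Q w -> ladder Q P (fun n => star (w n)).
Proof.
move=> h; split=> *; rewrite ?starK.
- exact: ladder_tgt0 h.
- exact: ladder_src0 h.
- exact: ladder_tgt_star h _.
- exact: ladder_src_star h _.
- exact: ladder_tgt_le h _ _ _.
- exact: ladder_src_le h _ _ _.
- exact: ladder_tgt h _.
- exact: ladder_src h _.
Qed.

Definition ladder_sum (w : nat -> C) (N : nat) : C := \sum_(n < N) w n.

Lemma ladder_sumS w N : ladder_sum w N.+1 = ladder_sum w N + w N.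
Proof. exact: big_ord_recr. Qed.

Lemma star_ladder_sum w N :
  star (ladder_sum w N) = ladder_sum (fun n => star (w n)) N.
Proof.
elim: N => [|N IH]; first by rewrite /ladder_sum !big_ord0 star0.
by rewrite !ladder_sumS starD IH.
Qed.

Section OneSided.
Context (P Q w : nat -> C).
Hypothesis h : ladder P Q w.
Local Notation s := (ladder_sum w).

Lemma ladder_src_le' m n : (n <= m)%N -> P n * P m = P m.
Proof.
move=> nm; rewrite -(ladder_src_star h n) -(ladder_src_star h m) -starM.
by rewrite (ladder_src_le h nm).
Qed.

Lemma ladder_rung_src n N : w n * P N = if (N <= n)%N then w n else 0.
Proof.
(* By the C*-identity, [w n * X = 0] can be tested on the source projection. *)
have wP (X : C) : star X = X -> (P n - P n.+1) * X = 0 -> w n * X = 0.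
  move=> sX hX; apply: starMl_eq0.
  by rewrite starM sX mulrA -(mulrA X) (ladder_src h) -mulrA hX mulr0.
case: leqP => Nn; last first.
  apply: wP; first exact: ladder_src_star h _.
  by rewrite mulrBl !ladder_src_le' ?subrr // ltnW.
apply/eqP; rewrite eq_sym -subr_eq0 -{1}(mulr1 (w n)) -mulrBr; apply/eqP.
apply: wP; first by rewrite starB star1 (ladder_src_star h).
rewrite mulrBr mulr1 mulrBl !(ladder_src_le h) ?subrr //.
exact: leq_trans Nn (leqnSn n).
Qed.

Lemma ladder_sum_src m n : (n <= m)%N -> s m * P n = s m - s n.
Proof.
move=> /subnKC <-; elim: (m - n)%N => [|k IH].
  rewrite addn0 subrr /ladder_sum mulr_suml big1 // => i _.
  by rewrite ladder_rung_src leqNgt ltn_ord.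
by rewrite addnS ladder_sumS mulrDl IH ladder_rung_src leq_addr addrAC.
Qed.

End OneSided.

Section TwoSided.
Context (P Q w : nat -> C).
Hypothesis h : ladder P Q w.
Local Notation s := (ladder_sum w).

Lemma ladder_tgt_sum m n : (n <= m)%N -> Q n * s m = s m - s n.
Proof.
move=> nm; rewrite -[LHS]starK starM (ladder_tgt_star h) star_ladder_sum.
rewrite (ladder_sum_src (ladder_dual h) nm) starB !star_ladder_sum.
by congr (_ - _); apply: eq_bigr => i _; rewrite starK.
Qed.

Lemma ladder_sum_rung n : star (s n) * w n = 0.
Proof.
have := ladder_rung_src (ladder_dual h) n n; rewrite leqnn => hw.
have -> : w n = Q n * w n.
  by rewrite -[RHS]starK starM (ladder_tgt_star h) hw starK.
have : star (Q n * s n) = 0 by rewrite ladder_tgt_sum // subrr star0.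
by rewrite starM (ladder_tgt_star h) mulrA => ->; rewrite mul0r.
Qed.

Lemma ladder_sum_isometry n : star (s n) * s n = 1 - P n.
Proof.
elim: n => [|n IH].
  by rewrite /ladder_sum big_ord0 mulr0 (ladder_src0 h) subrr.
rewrite ladder_sumS starD mulrDl !mulrDr IH ladder_sum_rung addr0.
rewrite -[star (w n) * s n]starK starM starK ladder_sum_rung star0 add0r.
by rewrite (ladder_src h) subrKA.
Qed.

Lemma ladder_sum_diff m n : (n <= m)%N ->
  star (s m - s n) * (s m - s n) = P n - P m.
Proof.
move=> nm; have e : s m - s n = s m * P n by rewrite (ladder_sum_src h nm).
rewrite e starM (ladder_src_star h) mulrA -(mulrA (P n)) ladder_sum_isometry.
rewrite mulrBr mulr1 mulrBl (ladder_src_le' h nm) (ladder_src_le h nm).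
by rewrite (ladder_src_le h).
Qed.

End TwoSided.

Section Limit.
Context (P Q w : nat -> C).
Hypothesis h : ladder P Q w.
Local Notation s := (ladder_sum w).
Context (H : hilbertType R) (Pi : C -> H -> H).
Hypothesis hPi : representation Pi.
Context (zeta omega : H).
Hypothesis Pi1 : forall x, Pi 1 x = x.
Hypothesis Plim : forall x, Pi (P n) x @[n --> \oo] --> theta zeta zeta x.
Hypothesis Pzeta : forall n, Pi (P n) zeta = zeta.
Hypothesis Qomega : forall n, Pi (Q n) omega = omega.
Hypothesis omega1 : inner omega omega = 1.

(** The sums converge strongly because the squared distance of two of them at [x] is a
difference of terms of the decreasing sequence of the squared norms of [Pi (P n) x]. *)
Lemma ladder_sum_cvg x : exists y : H, Pi (s n) x @[n --> \oo] --> y.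
Proof.
apply: (cvg_telescoping (r := fun n => `|Pi (P n) x| ^+ 2)).
  by move=> n; rewrite exprn_ge0.
move=> m n nm; rewrite -(repB hPi) -!inner_norm !(rep_innerr hPi) -!(rep_mul hPi).
rewrite (ladder_sum_diff h nm) !(ladder_src_star h) !(ladder_src_le h) //.
by rewrite (repB hPi) innerBl.
Qed.

Context (S : H -> H).
Hypothesis hS : forall x, Pi (s n) x @[n --> \oo] --> S x.
Let L x := S x + theta omega zeta x.

(** The vector [omega] is fixed by all the [Q n], whereas [Q n * s n = 0]. *)
Lemma ladder_limit_orth x : inner (S x) omega = 0.
Proof.
rewrite -[RHS](inner0r omega).
have c (z : H) : (fun=> z) @ \oo --> z by exact: cvg_cst.
apply: (inner_cvg_uniq (@hS x) (c omega) (c omega) (c 0)) => n.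
rewrite inner0r -{1}(Qomega n) (rep_innerr hPi) (ladder_tgt_star h) -(rep_mul hPi).
by rewrite (ladder_tgt_sum h) // subrr (rep0 hPi) inner0l.
Qed.

(** The limit [S] is isometric on the complement of the line of [zeta] and kills that
line; the rank one term sends [zeta] to [omega], which is orthogonal to the range of [S]. *)
Lemma ladder_limit_isometry x y : inner (L x) (L y) = inner x y.
Proof.
have hS2 : inner (S x) (S y) = inner (x - theta zeta zeta x) y.
  apply: (inner_cvg_uniq (@hS x) (@hS y) (cvgB (cvg_cst x) (@Plim x)) (cvg_cst y)) => n.
  rewrite (rep_innerr hPi) -(rep_mul hPi) (ladder_sum_isometry h) (repB hPi).
  by rewrite Pi1.
rewrite /L innerDl !innerDr hS2 /theta innerBl !innerZl !innerZr.
rewrite ladder_limit_orth (innerC omega (S y)) ladder_limit_orth omega1 rmorph0.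
by rewrite (innerC zeta y); ring.
Qed.

(** On both sides the rungs below [N] are removed and the rank one term remains, since
[zeta] is fixed by [P N]. In [ladder_tgt_limit] the projection acts on the range. *)
Lemma ladder_limit_src N x : L (Pi (P N) x) = L x - Pi (s N) x.
Proof.
rewrite /L; have -> : S (Pi (P N) x) = S x - Pi (s N) x.
  apply: (cvg_seq_uniq (@hS _)).
  have h2 : (fun n => Pi (s n) x - Pi (s N) x) @ \oo --> S x - Pi (s N) x.
    by apply: cvgB => //; exact: cvg_cst.
  apply: cvg_trans h2; apply: near_eq_cvg; exists N => // n /= Nn.
  by rewrite -(rep_mul hPi) (ladder_sum_src h Nn) (repB hPi).
have -> : theta omega zeta (Pi (P N) x) = theta omega zeta x.
  by rewrite /theta (rep_innerl hPi) (ladder_src_star h) Pzeta.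
by rewrite addrAC.
Qed.

Lemma ladder_tgt_limit N x : Pi (Q N) (L x) = L x - Pi (s N) x.
Proof.
rewrite /L (rep_vecD hPi) /theta (rep_vecZ hPi) Qomega.
suff -> : Pi (Q N) (S x) = S x - Pi (s N) x by rewrite addrAC.
apply: (cvg_seq_uniq (rep_cvg (a := Q N) hPi (@hS x))).
have h2 : (fun n => Pi (s n) x - Pi (s N) x) @ \oo --> S x - Pi (s N) x.
  by apply: cvgB => //; exact: cvg_cst.
apply: cvg_trans h2; apply: near_eq_cvg; exists N => // n /= Nn.
by rewrite -(rep_mul hPi) (ladder_tgt_sum h Nn) (repB hPi).
Qed.

End Limit.
End Ladder.

Section LimitAdjoint.
Context {R : realType} (C : cstarType R) (H : hilbertType R) (Pi : C -> H -> H).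
Hypothesis hPi : representation Pi.

Lemma limit_theta_adjoint (s : nat -> C) (S T : H -> H) (zeta omega : H) :
  (forall x, Pi (s n) x @[n --> \oo] --> S x) ->
  (forall x, Pi (star (s n)) x @[n --> \oo] --> T x) ->
  is_adjoint (fun x => S x + theta omega zeta x) (fun x => T x + theta zeta omega x).
Proof.
move=> hS hT x y; rewrite innerDl innerDr /theta innerZl innerZr.
have -> : inner (S x) y = inner x (T y).
  apply: (inner_cvg_uniq (hS x) (cvg_cst y) (cvg_cst x) (hT y)) => n.
  exact: rep_innerl.
by rewrite (innerC omega y) mulrC.
Qed.

End LimitAdjoint.

(** * Concrete algebras given by generators *)

Section BoundedOperators.
Context {R : realType} (H : hilbertType R).

Lemma cvg_norm_le (u : nat -> H) (l : H) (c : R[i]) (N : nat) :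
  u n @[n --> \oo] --> l -> (forall n, (N <= n)%N -> `|u n| <= c) -> `|l| <= c.
Proof.
move=> ul hu; apply/ler_addgt0Pr => e e0.
have [M hM] := (cvg_seqP _ _).1 ul _ e0.
have := hM _ (leq_maxl M N); have := hu _ (leq_maxr M N).
set k := maxn M N => h1 h2; rewrite -(subrK (u k) l) addrC.
by apply: le_trans (ler_normD _ _) _; rewrite lerD // ltW // distrC.
Qed.

End BoundedOperators.

Section ConcreteAlgebra.
Context {R : realType} (H : hilbertType R) (G : set (H -> H)).
Context (A : cstarType R) (incl : A -> H -> H).
Hypotheses (hincl : representation incl) (hincl_inj : injective incl).
Hypothesis hA : range incl = cstar_generated G.

Lemma generated_in_range T : G T -> exists a, incl a = T.
Proof.
move=> GT; suff : range incl T by move=> [a _ <-]; exists a.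
by rewrite hA => B _ GB; exact: GB.
Qed.

Lemma range_closed T : bounded_op T ->
  (forall e : R[i], 0 < e -> exists a, forall x, `|T x - incl a x| <= e * `|x|) ->
  exists a, incl a = T.
Proof.
move=> bT hT; suff : range incl T by move=> [a _ <-]; exists a.
rewrite hA => B hB GB; apply: (cstar_sub_closed hB) bT _ => e /hT [a ha].
exists (incl a) => //; have : range incl (incl a) by exists a.
by rewrite hA; apply.
Qed.

Definition op_bound (a : A) (c : R) : Prop := forall x, `|incl a x| <= c%:C * `|x|.

Lemma op_bound_star a c : op_bound a c -> op_bound (star a) c.
Proof.
move=> h y; have [->|n0] := eqVneq `|incl (star a) y| 0.
  exact: le_trans (normr_ge0 _) (h y).
rewrite -(@ler_pM2r _ `|incl (star a) y|); last by rewrite lt0r n0 normr_ge0.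
rewrite -expr2 -inner_norm (rep_innerl hincl) starK.
have h0 : 0 <= inner y (incl a (incl (star a) y)).
  by rewrite (rep_innerr hincl) inner_norm exprn_ge0.
rewrite -(ger0_norm h0); apply: le_trans (cauchy_schwarz _ _) _.
by rewrite mulrAC mulrC ler_wpM2r.
Qed.

(** Completeness is the point: a sequence that is Cauchy in operator norm has a pointwise
limit, this limit is bounded, and it is in the range because the range is closed. *)
Lemma op_bound_norm_bound : norm_bound op_bound.
Proof.
split.
- by move=> x c d h cd y; apply: le_trans (h y) _; rewrite ler_wpM2r // lecR.
- move=> x y c d hx hy z; rewrite (repD hincl) rmorphD /= mulrDl.
  by apply: le_trans (ler_normD _ _) (lerD (hx z) (hy z)).
- move=> x y c d c0 d0 hx hy z; rewrite (rep_mul hincl) rmorphM /= -mulrA.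
  by apply: le_trans (hx _) _; rewrite ler_wpM2l ?lecR.
- move=> x t c t0 hx z; rewrite (repZ hincl) normrZ rmorphM /= -mulrA.
  by rewrite ger0_norm ?lecR // ler_wpM2l ?lecR.
- by move=> x c hx z; rewrite (repN hincl) normrN.
- exact: op_bound_star.
- by move=> z; rewrite (rep0 hincl) normr0 mul0r.
- move=> x h; apply: hincl_inj; apply/funext => z; rewrite (rep0 hincl).
  apply: small_norm0 => _ /gt0_realC [e e0 <-].
  have [n n0 nx] := ge0_realC (normr_ge0 z).
  have d0 : 0 < e / (n + 1) by rewrite divr_gt0 //; lra.
  apply: le_lt_trans (h _ d0 z) _; rewrite -nx -rmorphM ltcR.
  by rewrite mulrAC ltr_pdivrMr ?ltr_pM2l //; lra.
move=> u hu.
have cau z : exists y : H, incl (u n) z @[n --> \oo] --> y.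
  apply: cauchy_seq_cvg => _ /gt0_realC [e e0 <-].
  have [n n0 nx] := ge0_realC (normr_ge0 z).
  have d0 : 0 < e / (n + 1) by rewrite divr_gt0 //; lra.
  have [N hN] := hu _ d0; exists N => m k Nm Nk.
  rewrite -(repB hincl); apply: le_lt_trans (hN _ _ Nm Nk z) _.
  rewrite -nx -rmorphM ltcR.
  by rewrite mulrAC ltr_pdivrMr ?ltr_pM2l //; lra.
have [T hT] := choice cau.
have lT : linear T.
  move=> c x y; apply: (cvg_seq_uniq (hT _)).
  rewrite (_ : (fun n => _) = fun n => c *: incl (u n) x + incl (u n) y).
    by apply: cvgD; [apply: cvgZr|].
  by apply/funext => n; rewrite (rep_vecP hincl).
have close e : 0 < e -> exists N, forall n, (N <= n)%N ->
    forall x, `|incl (u n) x - T x| <= e%:C * `|x|.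
  move=> e0; have [N hN] := hu _ e0; exists N => n Nn x.
  apply: (@cvg_norm_le _ _ (fun m => incl (u n) x - incl (u m) x) _ _ N).
    by apply: cvgB => //; exact: cvg_cst.
  by move=> m Nm; rewrite -(repB hincl); exact: hN.
have bT : bounded_op T.
  have [N hN] := close 1 ltr01.
  have [c c0 hc] := bounded_op_bound (rep_bounded hincl (u N)).
  apply: (@bound_bounded_op _ _ _ _ (c + 1) lT).
    by rewrite addr_ge0 // ltW.
  move=> x; rewrite -(subrK (incl (u N) x) (T x)) addrC mulrDl.
  apply: le_trans (ler_normD _ _) _; rewrite lerD // distrC mul1r.
  by have := hN N (leqnn N) x; rewrite rmorph1 mul1r.
have [l hl] : exists l, incl l = T.
  apply: range_closed => // _ /gt0_realC [e e0 <-].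
  have [N hN] := close _ e0; exists (u N) => x; rewrite distrC; exact: hN.
exists l => e e0; have [N hN] := close _ e0; exists N => n Nn x.
by rewrite (repB hincl) hl; exact: hN.
Qed.

(** The elements [a] such that [rho a] and [rho (star a)] preserve [N] form a C*-subalgebra.
Its closedness uses that [rho] is continuous for the operator norm of [H]. *)
Lemma generated_invariant (K : hilbertType R) (rho : A -> K -> K) (N : set K) :
  representation rho -> closed_subspace N ->
  (forall a x, G (incl a) -> N x -> N (rho a x) /\ N (rho (star a) x)) ->
  invariant_subspace rho N.
Proof.
move=> hrho hN hGN; split=> //.
have [N0 NL Nc] := hN.
pose B := [set T | exists2 a, incl a = T &
  forall x, N x -> N (rho a x) /\ N (rho (star a) x)].
suff hB : cstar_subalgebra B.
  move=> a x Nx; have : range incl (incl a) by exists a.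
  rewrite hA => /(_ B hB) [|b /hincl_inj -> h]; last by case: (h x Nx).
  by move=> T GT; have [b hb] := generated_in_range GT; exists b => // y;
    apply: hGN; rewrite hb.
split.
- by move=> _ [a <- _]; exact: rep_bounded.
- move=> c _ _ [a <- ha] [b <- hb]; exists (c *: a + b).
    by apply/funext => x; rewrite (rep_linear hincl).
  move=> x Nx; have [ha1 ha2] := ha _ Nx; have [hb1 hb2] := hb _ Nx.
  by rewrite star_antilinear !(rep_linear hrho); split; exact: NL.
- move=> _ _ [a <- ha] [b <- hb]; exists (a * b).
    by apply/funext => x; rewrite (rep_mul hincl).
  move=> x Nx; rewrite starM !(rep_mul hrho); split.
    by have [/ha[]] := hb _ Nx.
  by have [_ /hb[]] := ha _ Nx.
- move=> _ T' [a <- ha] bT' adj; exists (star a).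
    exact: adjoint_uniq (rep_star hincl a) adj.
  by move=> x Nx; rewrite starK; have [] := ha _ Nx.
- move=> T bT hT.
  have [a ha] : exists a, incl a = T.
    by apply: range_closed => // e /hT [_ [a <- _] h]; exists a.
  exists a => //.
  have h n : exists b, op_bound (b - a) (n.+1%:R^-1) /\
      forall x, N x -> N (rho b x) /\ N (rho (star b) x).
    have e0 : 0 < (n.+1%:R^-1 : R)%:C by rewrite ltcR invr_gt0.
    have [_ [b <- hb] hb'] := hT _ e0; exists b; split => // x.
    by rewrite (repB hincl) ha distrC.
  have [b hb] := choice h.
  have conv e : 0 < e -> exists N, forall n, (N <= n)%N -> op_bound (b n - a) e.
    move=> /inv_succ_small [M hM]; exists M => n /hM /ltW.
    exact: (bd_le op_bound_norm_bound) (hb n).1.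
  move=> x Nx; split.
    have cx := rep_approx op_bound_norm_bound hrho (x := x) conv.
    apply: (closed_seq (u := fun n => rho (b n) x) Nc _ cx) => n.
    by have [] := (hb n).2 x Nx.
  have conv' e : 0 < e -> exists N, forall n, (N <= n)%N ->
      op_bound (star (b n) - star a) e.
    move=> /conv [M hM]; exists M => n /hM h'; rewrite -starB.
    exact: op_bound_star.
  have cx := rep_approx op_bound_norm_bound hrho (x := x) conv'.
  apply: (closed_seq (u := fun n => rho (star (b n)) x) Nc _ cx) => n.
  by have [] := (hb n).2 x Nx.
Qed.

End ConcreteAlgebra.

(** * The unitaries of the construction *)

(** What the sequel uses of the construction of [A]: it refers neither to the space [H] nor
to the limits defining the unitaries, only to relations in [A] and to the fact that [A]
is generated by [C] and the [l i]. *)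
Record linked {R : realType} (C A : cstarType R) (I : Type) (q : nat -> C)
    (alpha : I -> C -> C) (s : I -> nat -> C) (j : C -> A) (l : I -> A) : Prop := {
  linked_linear : linear j ;
  linked_mul : forall a b, j (a * b) = j a * j b ;
  linked_star : forall a, j (star a) = star (j a) ;
  linked_one : j 1 = 1 ;
  linked_isometry : forall i, star (l i) * l i = 1 ;
  linked_coisometry : forall i, l i * star (l i) = 1 ;
  linked_src : forall i n, l i * j (alpha i (q n)) = l i - j (s i n) ;
  linked_tgt : forall i n, j (q n) * l i = l i - j (s i n) ;
  linked_invariant : forall (K : hilbertType R) (rho : A -> K -> K) (N : set K),
    representation rho -> closed_subspace N ->
    (forall a x, N x -> N (rho (j a) x)) ->
    (forall i x, N x -> N (rho (l i) x) /\ N (rho (star (l i)) x)) ->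
    invariant_subspace rho N }.

Section Construction.
Unset Implicit Arguments.
Context (R : realType)
  (C : cstarType R) (iota : forall n, 'M[R[i]]_(cdim n) -> C)
  (hC : car_algebra iota)
  (I : Type) (r : I) (phi : I -> {scalar C})
  (Hs : I -> hilbertType R) (pi : forall i, C -> Hs i -> Hs i)
  (xi : forall i, Hs i)
  (hpure : forall i, pure_state (phi i))
  (hgns : forall i, gns_triple (phi i) (pi i) (xi i))
  (hirr : forall i, nonzero_irreducible_rep (pi i))
  (hclass : forall (K : hilbertType R) (sigma : C -> K -> K),
    nonzero_irreducible_rep sigma ->
    exists! i, unitarily_equivalent sigma (pi i))
  (hphir : first_coordinate_product_state iota (phi r))
  (alpha : I -> C -> C)
  (halpha : forall i, star_automorphism (alpha i))
  (halpha_phi : forall i a, phi i (alpha i a) = phi r a)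
  (halpha_r : forall a, alpha r a = a).
Set Implicit Arguments.
Local Notation q := (car_q iota).

Lemma phi_r_q n : phi r (q n) = 1.
Proof. by rewrite /car_q hphir big1 // => k _; rewrite mxE !eqxx. Qed.

Lemma alpha_surj i b : exists a, alpha i a = b.
Proof. by have [_ _ _ [g _ gK]] := halpha i; exists (g b). Qed.

Lemma alpha1 i : alpha i 1 = 1.
Proof.
have [_ mul _ _] := halpha i; have [a ha] := alpha_surj i 1.
by have := mul 1 a; rewrite mul1r ha mulr1.
Qed.

Lemma alpha_twist i (K : hilbertType R) (sigma : C -> K -> K) :
  representation sigma -> representation (fun a => sigma (alpha i a)).
Proof. by have [? ? ? _] := halpha i; exact: rep_twist. Qed.

(** For [x] of norm [1] this says that [x] has the vector state [phi i]; compare [car_fixed]. *)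
Definition excised i (K : hilbertType R) (sigma : C -> K -> K) (x : K) : Prop :=
  car_fixed iota (fun a => sigma (alpha i a)) x.

Lemma gns_norm i : inner (xi i) (xi i) = 1.
Proof.
have [hr cl hs] := hgns i; have [[_ st1] _] := hpure i.
by rewrite -st1 hs (cyclic_rep1 hr cl).
Qed.

(** Since [phi i (p i n) = 1], the projection [p i n] fixes the cyclic vector. *)
Lemma gns_excised i : excised i (pi i) (xi i).
Proof.
move=> n; have [hr cl hs] := hgns i; have hr' := alpha_twist i hr.
have e1 : inner (pi i (alpha i (q n)) (xi i)) (xi i) = 1.
  by rewrite -hs halpha_phi phi_r_q.
apply/eqP; rewrite -subr_eq0 -normr_eq0 -sqrf_eq0 -inner_norm.
rewrite innerBl !innerBr {1}[inner (pi _ _ _) (pi _ _ _)](rep_innerr hr').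
rewrite -(rep_mul hr') (car_q_star hC) (car_q_idem hC) e1 gns_norm.
by rewrite innerC e1 rmorph1 subrr.
Qed.

Lemma excised_same_state i (K1 K2 : hilbertType R) (s1 : C -> K1 -> K1)
    (s2 : C -> K2 -> K2) x1 x2 a :
  representation s1 -> representation s2 -> excised i s1 x1 -> excised i s2 x2 ->
  inner x1 x1 = inner x2 x2 -> inner (s1 a x1) x1 = inner (s2 a x2) x2.
Proof.
move=> h1 h2 f1 f2 e; have [b <-] := alpha_surj i a.
exact: (car_fixed_state hC b (alpha_twist i h1) (alpha_twist i h2)).
Qed.

Lemma excised_scale i (K : hilbertType R) (sigma : C -> K -> K) c x :
  representation sigma -> excised i sigma x -> excised i sigma (c *: x).
Proof. by move=> hs hx n; rewrite (rep_vecZ hs) hx. Qed.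

(** A nonzero such vector generates a copy of [pi i] in the irreducible [pi k], and the
representations of the family are pairwise inequivalent. *)
Lemma excised_index i k y : excised i (pi k) y -> y <> 0 -> k = i.
Proof.
move=> hy y0; have [hr cl hs] := hgns i; have [hk _ _] := hirr k.
have /eqP ny : `|y| != 0 by rewrite normr_eq0; apply/eqP.
pose y1 := `|y|^-1 *: y.
have ny1 : inner y1 y1 = 1.
  by rewrite inner_norm /y1 normfZV ?expr1n //; apply/eqP.
have y10 : y1 <> 0.
  by move=> e; move: ny1; rewrite e inner0l => /eqP; rewrite eq_sym oner_eq0.
have eqv : unitarily_equivalent (pi k) (pi i).
  apply: (cyclic_equivalent hk hr _ (irreducible_cyclic (hirr k) y10) cl).
  move=> a; apply: excised_same_state => //; [exact: excised_scale|exact: gns_excised|].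
  by rewrite ny1 gns_norm.
have [i0 [_ u0]] := hclass _ _ (hirr k).
rewrite -(u0 i eqv); apply/esym/u0; exists id; split=> // y'; by exists y'.
Qed.

Unset Implicit Arguments.
Context (H : hilbertType R) (V : forall i, Hs i -> H)
  (hH : hilbert_direct_sum V)
  (Pi : C -> H -> H) (hPi : representation Pi)
  (hPi_sum : forall a i x, Pi a (V i x) = V i (pi i a x))
  (zeta : I -> H) (hzeta : forall i, zeta i = V i (xi i)).
Set Implicit Arguments.

Let V_linear i : linear (V i). Proof. by case: hH. Qed.
Let V_inner i x y : inner (V i x) (V i y) = inner x y. Proof. by case: hH. Qed.

Let V_norm i x : `|V i x| = `|x|.
Proof. exact/norm_inner_eq/V_inner. Qed.

Lemma sum_orth (z : H) : (forall i x, inner z (V i x) = 0) -> z = 0.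
Proof.
move=> hz; have [_ _ _ full] := hH.
suff : [set y | inner z y = 0] = setT.
  by move=> e; apply: inner_eq0 => y; have : [set y | inner z y = 0] y by rewrite e.
apply: full; last exact: hz.
split; first exact: inner0r.
- by move=> c x y /= hx hy; rewrite innerDr innerZr hx hy mulr0 addr0.
- apply: closed_from_seq => u l hu ul /=; rewrite -[RHS](inner0r z).
  apply: (inner_cvg_uniq (cvg_cst z) ul (cvg_cst z) (cvg_cst 0)) => n.
  by rewrite inner0r; exact: hu.
Qed.

Lemma Pi1 x : Pi 1 x = x.
Proof.
apply/eqP; rewrite -subr_eq0; apply/eqP/sum_orth => i y.
have [hr cl _] := hgns i.
by rewrite innerBl (rep_innerl hPi) star1 hPi_sum (cyclic_rep1 hr cl) subrr.
Qed.

Lemma zeta_norm i : inner (zeta i) (zeta i) = 1.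
Proof. by rewrite hzeta V_inner gns_norm. Qed.

Lemma zeta_excised i : excised i Pi (zeta i).
Proof. by move=> n; rewrite hzeta hPi_sum gns_excised. Qed.

(** The limit of [pi k (p i n) y] is a fixed vector of [pi k]; it is [0] unless [k = i], and
then it is a multiple of [xi i]. In both cases its image is orthogonal to [z]. *)
Lemma excised_sum i z : excised i Pi z -> inner z (zeta i) = 0 -> z = 0.
Proof.
move=> hz zz; apply: sum_orth => k y; have [hr cl _] := hgns k.
have [y' yy' hy'] := car_q_cvg hC y (alpha_twist i hr).
have zy' : inner z (V k y') = 0.
  have [->|/eqP y0] := eqVneq y' 0.
    have -> : V k 0 = 0 by apply/eqP; rewrite -normr_eq0 V_norm normr0.
    exact: inner0r.
  have ki := excised_index hy' y0; move: y' {yy' y0} hy'; rewrite ki => y' hy'.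
  have [hri cli _] := hgns i.
  have cli' : closure (range (fun a => pi i (alpha i a) (xi i))) = setT.
    rewrite -cli; congr closure; apply/seteqP; split=> [_ [a _ <-]|_ [a _ <-]].
      by exists (alpha i a).
    by have [b <-] := alpha_surj i a; exists b.
  have := car_fixed_cyclic hC (alpha_twist i hri) cli' (@gns_excised i) hy' (gns_norm i).
  move=> ->; have := @V_linear i (inner y' (xi i)) (xi i) 0; rewrite !addr0.
  have -> : V i 0 = 0 by apply/eqP; rewrite -normr_eq0 V_norm normr0.
  by rewrite addr0 => ->; rewrite innerZr -hzeta zz mulr0.
rewrite -zy'.
have Vc : V k (pi k (alpha i (q n)) y) @[n --> \oo] --> V k y'.
  apply/cvg_seqP => e /((cvg_seqP _ _).1 yy') [N hN]; exists N => n /hN.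
  by rewrite -V_norm addrC -scaleN1r V_linear scaleN1r addrC.
apply: (inner_cvg_uniq (cvg_cst z) (cvg_cst (V k y)) (cvg_cst z) Vc) => n.
have [_ _ st _] := halpha i.
by rewrite -hPi_sum (rep_innerr hPi) -st (car_q_star hC) (hz n).
Qed.

(** By the preceding lemma the fixed vectors in the direct sum are the multiples of
[zeta i]. *)
Lemma excision_limit i x :
  Pi (alpha i (q n)) x @[n --> \oo] --> theta (zeta i) (zeta i) x.
Proof.
have [y xy hy] := car_q_cvg hC x (alpha_twist i hPi).
suff -> : theta (zeta i) (zeta i) x = y by [].
have -> : theta (zeta i) (zeta i) x = inner y (zeta i) *: zeta i.
  congr (_ *: _); apply: (inner_cvg_uniq (cvg_cst x) (cvg_cst (zeta i)) xy (cvg_cst (zeta i))).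
  move=> n; have [_ _ st _] := halpha i.
  by rewrite (rep_innerl hPi) -st (car_q_star hC) zeta_excised.
apply/esym/eqP; rewrite -subr_eq0; apply/eqP/(@excised_sum i).
  move=> n; have ht := alpha_twist i hPi.
  by rewrite (rep_vecB ht) (rep_vecZ ht) hy zeta_excised.
by rewrite innerBl innerZl zeta_norm mulr1 subrr.
Qed.


Unset Implicit Arguments.
Context (p e : I -> nat -> C)
  (hp : forall i n, p i n = alpha i (car_q iota n))
  (he : forall i n, e i n = p i n - p i n.+1)
  (w : I -> nat -> C)
  (hw_source : forall i n, star (w i n) * w i n = e i n)
  (hw_range : forall i n, w i n * star (w i n) = car_f iota n)
  (s : I -> nat -> C)
  (hs : forall i N, s i N = \sum_(n < N) w i n)
  (S : I -> H -> H)
  (hS : forall i x, Pi (s i N) x @[N --> \oo] --> S i x)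
  (L : I -> H -> H)
  (hL : forall i x, L i x = S i x + theta (zeta r) (zeta i) x)
  (A : cstarType R) (incl : A -> H -> H)
  (hincl : representation incl) (hincl_inj : injective incl)
  (hA : range incl = cstar_generated (range Pi `|` range L)).
Set Implicit Arguments.

Lemma ladder_w i : ladder (fun n => alpha i (q n)) q (w i).
Proof.
have [_ mul st _] := halpha i; split.
- by rewrite (car_q0 hC) alpha1.
- exact: car_q0.
- by move=> n; rewrite -st (car_q_star hC).
- exact: car_q_star.
- by move=> m n nm; rewrite -mul (car_q_le hC).
- by move=> m n nm; rewrite (car_q_le hC).
- by move=> n; rewrite hw_source he !hp.
- by move=> n; rewrite hw_range.
Qed.

Lemma q_limit x : Pi (q n) x @[n --> \oo] --> theta (zeta r) (zeta r) x.
Proof.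
have := @excision_limit r x.
by rewrite (_ : (fun n => _) = fun n => Pi (q n) x) //; apply/funext => n; rewrite halpha_r.
Qed.

Lemma q_zeta n : Pi (q n) (zeta r) = zeta r.
Proof. by have := @zeta_excised r n; rewrite halpha_r. Qed.

Let sE i N : s i N = ladder_sum (w i) N. Proof. exact: hs. Qed.

Lemma construction_linked : exists (j : C -> A) (l : I -> A),
  linked q alpha s j l.
Proof.
have /choice [j hj] : forall c, exists a, incl a = Pi c.
  by move=> c; apply: (generated_in_range hA); left; exists c.
have /choice [l hl] : forall i, exists a, incl a = L i.
  by move=> i; apply: (generated_in_range hA); right; exists i.
have ext a b : (forall x, incl a x = incl b x) -> a = b.
  by move=> h; apply: hincl_inj; exact/funext.
(* The unit of [A] acts on [H] as the identity because [Pi 1] does. *)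
have j1 : j 1 = 1.
  by rewrite -[LHS]mulr1; apply: ext => x; rewrite (rep_mul hincl) hj Pi1.
have incl1 x : incl 1 x = x by rewrite -j1 hj Pi1.
have hS' i x : Pi (ladder_sum (w i) n) x @[n --> \oo] --> S i x.
  by rewrite (_ : (fun n => _) = fun n => Pi (s i n) x) //; apply/funext => n; rewrite sE.
have hT i x : exists y : H, Pi (star (ladder_sum (w i) n)) x @[n --> \oo] --> y.
  have [y hy] := ladder_sum_cvg (ladder_dual (ladder_w i)) hPi x.
  exists y; move: hy; rewrite (_ : (fun n => _) = fun n => Pi (star (ladder_sum (w i) n)) x) //.
  by apply/funext => n; rewrite star_ladder_sum.
have lstar i : exists2 T : H -> H,
    (forall x, Pi (star (ladder_sum (w i) n)) x @[n --> \oo] --> T x) &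
    incl (star (l i)) = (fun x => T x + theta (zeta i) (zeta r) x).
  have [T hTi] := choice (hT i); exists T => //.
  apply: adjoint_uniq (rep_star hincl (l i)) _.
  rewrite hl (_ : L i = fun x => S i x + theta (zeta r) (zeta i) x); last first.
    by apply/funext.
  exact: limit_theta_adjoint (hS' i) hTi.
exists j, l; split.
- by move=> c a b; apply: ext => x; rewrite (rep_linear hincl) !hj (rep_linear hPi).
- by move=> a b; apply: ext => x; rewrite (rep_mul hincl) !hj (rep_mul hPi).
- move=> a; apply: hincl_inj; apply: (adjoint_uniq (T := Pi a)).
    by rewrite hj; exact: rep_star.
  by rewrite -hj; exact: rep_star.
- exact: j1.
- move=> i; apply: ext => x; apply: inner_inj => y.
  rewrite incl1 (rep_mul hincl) (rep_innerl hincl) starK hl !hL.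
  exact: (ladder_limit_isometry (ladder_w i) hPi Pi1 (@excision_limit i) q_zeta
    (zeta_norm r) (hS' i)).
- move=> i; apply: ext => x; apply: inner_inj => y; have [T hTi lT] := lstar i.
  rewrite incl1 (rep_mul hincl) (rep_innerl hincl) lT.
  apply: (ladder_limit_isometry (ladder_dual (ladder_w i)) hPi Pi1 q_limit
    (@zeta_excised i) (zeta_norm i)) => z.
  rewrite (_ : (fun n => _) = fun n => Pi (star (ladder_sum (w i) n)) z) //.
  by apply/funext => n; rewrite star_ladder_sum.
- move=> i n; apply: ext => x.
  rewrite (rep_mul hincl) (repB hincl) !hj hl sE !hL.
  exact: (@ladder_limit_src _ _ _ _ _ (ladder_w i) _ _ hPi _ (zeta r)
    (@zeta_excised i) _ (hS' i)).
- move=> i n; apply: ext => x.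
  rewrite (rep_mul hincl) (repB hincl) !hj hl sE !hL.
  exact: (@ladder_tgt_limit _ _ _ _ _ (ladder_w i) _ _ hPi (zeta i) _
    q_zeta _ (hS' i)).
- move=> K rho N hrho hN hj' hl'.
  apply: (generated_invariant hincl hincl_inj hA hrho hN) => a x [[c _ hc]|[i _ hi]] Nx.
    have -> : a = j c by apply: hincl_inj; rewrite hj.
    have -> : star (j c) = j (star c).
      apply: hincl_inj; apply: (adjoint_uniq (T := Pi c)).
        by rewrite -hj; exact: rep_star.
      by rewrite hj; exact: rep_star.
    by split; exact: hj'.
  have -> : a = l i by apply: hincl_inj; rewrite hl.
  exact: hl'.
Qed.

End Construction.

(** * States of the family in irreducible representations *)

Section Subrepresentation.
Context {R : realType} (C : cstarType R) (K : hilbertType R) (sigma : C -> K -> K).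
Context (M : set K).
Hypotheses (hs : representation sigma) (hM : closed_subspace M).
Hypothesis MM : forall a x, M x -> M (sigma a x).

Lemma subrepresentation : exists2 tau : C -> subhilb hM -> subhilb hM,
  representation tau & forall a y, val (tau a y) = sigma a (val y).
Proof.
have h (ay : C * subhilb hM) : exists z : subhilb hM, val z = sigma ay.1 (val ay.2).
  by apply: subhilb_subP; apply: MM; exact: subhilb_valP.
have [t ht] := choice h.
have tE a y : val (t (a, y)) = sigma a (val y) by exact: ht.
exists (fun a y => t (a, y)) => //.
split.
- move=> a; have [c c0 hc] := bounded_op_bound (rep_bounded hs a).
  apply: (@bound_bounded_op _ _ _ _ c) => [d x y||x]; last 2 first.
  + exact: ltW.
  + by rewrite !subhilb_normE tE.
  by apply: val_inj; rewrite subhilb_val_linear !tE subhilb_val_linear (rep_vecP hs).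
- move=> c a b x; apply: val_inj; rewrite subhilb_val_linear !tE.
  exact: rep_linear.
- by move=> a b x; apply: val_inj; rewrite !tE (rep_mul hs).
- by move=> a x y; rewrite !subhilb_innerE !tE; exact: rep_star hs _ _ _.
Qed.

Lemma subrepresentation_irreducible (tau : C -> subhilb hM -> subhilb hM) :
  (forall a y, val (tau a y) = sigma a (val y)) ->
  irreducible_on sigma M -> irreducible_on tau setT.
Proof.
move=> ht irr N' [[N0 NL Nc] NI] _.
pose N := [set val y | y in N'].
have [] := irr N.
- split; [split|].
  + by exists 0 => //; rewrite raddf0.
  + move=> c _ _ [x Nx <-] [y Ny <-]; exists (c *: x + y); first exact: NL.
    by rewrite linearP.
  + apply: closed_from_seq => u l hu ul.
    have /choice [v hv] : forall n, exists y, N' y /\ val y = u n.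
      by move=> n; have [y Ny yu] := hu n; exists y.
    have Ml : M l.
      have [_ _ Mc] := hM; apply: (closed_seq Mc _ ul) => n.
      by rewrite -(hv n).2; exact: subhilb_valP.
    have [y hy] := subhilb_subP hM Ml; exists y => //.
    apply: (closed_seq (u := v) Nc) => [n|]; first exact: (hv n).1.
    apply/subhilb_cvg; rewrite hy (_ : (fun n => _) = u) //.
    by apply/funext => n; rewrite (hv n).2.
  + by move=> a _ [y Ny <-]; exists (tau a y); [exact: NI|rewrite ht].
- by move=> _ [y _ <-]; exact: subhilb_valP.
- move=> e; left; apply/seteqP; split=> [y Ny|y ->] //.
  have : N (val y) by exists y.
  by rewrite e => y0; apply: val_inj; rewrite y0 raddf0.
- move=> e; right; apply/seteqP; split=> // y _.
  have : N (val y) by rewrite e; exact: subhilb_valP.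
  by move=> [z Nz /val_inj <-].
Qed.

End Subrepresentation.

Section Linked.
Unset Implicit Arguments.
Context (R : realType)
  (C : cstarType R) (iota : forall n, 'M[R[i]]_(cdim n) -> C)
  (hC : car_algebra iota)
  (I : Type) (r : I) (alpha : I -> C -> C)
  (halpha : forall i, star_automorphism (alpha i))
  (halpha_r : forall a, alpha r a = a)
  (s : I -> nat -> C)
  (A : cstarType R) (j : C -> A) (l : I -> A)
  (hj : linked (car_q iota) alpha s j l).
Local Notation q := (car_q iota).

Section OneRep.
Context (K : hilbertType R) (rho : A -> K -> K) (hrho : representation rho).
Set Implicit Arguments.

Lemma restricted_rep : representation (fun a => rho (j a)).
Proof.
split.
- by move=> a; exact: rep_bounded.
- by move=> c a b x; rewrite (linked_linear hj) (rep_linear hrho).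
- by move=> a b x; rewrite (linked_mul hj) (rep_mul hrho).
- by move=> a; rewrite (linked_star hj); exact: rep_star.
Qed.

(** These vectors form the space [K_i] of the opening comment. *)
Definition has_state i (x : K) : Prop := excised iota alpha i (fun a => rho (j a)) x.

(** From [j (q n) * l i = l i * j (p i n)]. *)
Lemma has_state_move i x : has_state i x -> has_state r (rho (l i) x).
Proof.
move=> hx n; rewrite halpha_r -(rep_mul hrho) (linked_tgt hj) -(linked_src hj).
by rewrite (rep_mul hrho) (hx n).
Qed.

Lemma has_state_move_back i x : has_state r x -> has_state i (rho (star (l i)) x).
Proof.
move=> hx n; have [_ _ st _] := halpha i; have qs := car_q_star hC n.
have e : j (alpha i (q n)) * star (l i) = star (l i) * j (q n).
  rewrite -{1}qs st (linked_star hj) -starM (linked_src hj) -(linked_tgt hj).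
  by rewrite starM -(linked_star hj) qs.
by rewrite -(rep_mul hrho) e (rep_mul hrho) -{1}(halpha_r (q n)) (hx n).
Qed.

Lemma linked_neq0 i x : rho 1 x = x -> x <> 0 -> rho (l i) x <> 0.
Proof.
move=> x1 x0 e; apply: x0; rewrite -x1 -(linked_isometry hj i) (rep_mul hrho) e.
exact: rep_vec0.
Qed.

Lemma linked_star_neq0 i x : rho 1 x = x -> x <> 0 -> rho (star (l i)) x <> 0.
Proof.
move=> x1 x0 e; apply: x0; rewrite -x1 -(linked_coisometry hj i) (rep_mul hrho) e.
exact: rep_vec0.
Qed.

Lemma has_state_rep1 i x : has_state i x -> rho 1 x = x.
Proof.
move=> hx; rewrite -{1}(hx 0%N) -(rep_mul hrho) mul1r; exact: hx.
Qed.

(** The projections [rho (j (p i n))] tend strongly to [0] on [M], so on [N] the relations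
express [rho (l i)] and its adjoint as strong limits of elements of [C]. *)
Lemma invariant_of_no_state (M : set K) :
  invariant_subspace rho M ->
  (forall i x, M x -> has_state i x -> x = 0) ->
  forall N, closed_subspace N -> (forall a x, N x -> N (rho (j a) x)) -> N `<=` M ->
    invariant_subspace rho N.
Proof.
move=> [[_ _ Mc] MI] hno N hN NI NM; apply: (linked_invariant hj) => // i x Nx.
(* Used at the index [i], and at [r], where [p r n = q n], for the adjoint of [rho (l i)]. *)
have van k : rho (j (alpha k (q n))) x @[n --> \oo] --> (0 : K).
  have [y xy hy] := car_q_cvg hC x (alpha_twist halpha k restricted_rep).
  rewrite -(hno k y) //; apply: (closed_seq Mc _ xy) => n.
  exact/MI/NM.
have [_ _ Nc] := hN.
split.
  apply: (closed_seq (u := fun n => rho (j (s i n)) x) Nc) => [n|]; first exact: NI.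
  rewrite (_ : (fun n => _) = fun n => rho (l i) x - rho (l i) (rho (j (alpha i (q n))) x)).
    rewrite -[X in _ --> X]subr0 -(rep_vec0 hrho (l i)).
    apply: cvgB; first exact: cvg_cst.
    by apply: rep_cvg.
  apply/funext => n; rewrite -(rep_mul hrho) (linked_src hj) (repB hrho).
  by rewrite opprB addrC subrK.
apply: (closed_seq (u := fun n => rho (j (star (s i n))) x) Nc) => [n|]; first exact: NI.
rewrite (_ : (fun n => _) =
    fun n => rho (star (l i)) x - rho (star (l i)) (rho (j (alpha r (q n))) x)).
  rewrite -[X in _ --> X]subr0 -(rep_vec0 hrho (star (l i))).
  apply: cvgB; first exact: cvg_cst.
  by apply: rep_cvg.
apply/funext => n; rewrite -(rep_mul hrho) halpha_r.
have -> : star (l i) * j (q n) = star (l i) - j (star (s i n)).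
  rewrite -{1}(car_q_star hC n) !(linked_star hj) -starM (linked_tgt hj) starB.
  by rewrite -(linked_star hj).
by rewrite (repB hrho) opprB addrC subrK.
Qed.

Unset Implicit Arguments.
Context (Hs : I -> hilbertType R) (pi : forall i, C -> Hs i -> Hs i)
  (xi : forall i, Hs i)
  (hclass : forall (K : hilbertType R) (sigma : C -> K -> K),
    nonzero_irreducible_rep sigma ->
    exists! i, unitarily_equivalent sigma (pi i))
  (hxi : forall i, excised iota alpha i (pi i) (xi i))
  (hxi1 : forall i, inner (xi i) (xi i) = 1).
Set Implicit Arguments.

(** Otherwise the restriction of [rho] to [C] would be irreducible on [M], hence equivalent
to some [pi i], and the vector corresponding to [xi i] would be such an [x]. *)
Lemma irreducible_has_state (M : set K) :
  invariant_subspace rho M -> nonzero_on rho M -> irreducible_on rho M ->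
  exists i x, [/\ M x, x <> 0 & has_state i x].
Proof.
move=> invM [a0 [x0 Mx0 ax0]] irr; apply: contrapT => hno.
have hno' i x : M x -> has_state i x -> x = 0.
  by move=> Mx hx; apply: contrapT => xn; apply: hno; exists i, x.
have [hM MI] := invM.
have irrC : irreducible_on (fun a => rho (j a)) M.
  move=> N [hN NI] NM; apply: irr => //.
  exact: invariant_of_no_state hN NI NM.
have MIC a x : M x -> M (rho (j a) x) by move=> Mx; exact: MI.
have [tau htau tauE] := subrepresentation restricted_rep hM MIC.
have tirr := subrepresentation_irreducible tauE irrC.
have [|i [[U [Ulin Uin Usurj UI]] _]] := hclass _ tau.
  split=> //; have [y0 hy0] := subhilb_subP hM Mx0; exists 1, y0 => // e.
  apply: ax0; rewrite -[a0]mulr1 (rep_mul hrho) -(linked_one hj) -hy0 -tauE e.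
  by rewrite raddf0 (rep_vec0 hrho).
have [x hx] := Usurj (xi i).
have Unorm y : `|U y| = `|y| by exact/norm_inner_eq/Uin.
have xn : x <> 0.
  move=> e; have : inner (xi i) (xi i) = 0.
    by rewrite -hx inner_norm Unorm e normr0 expr0n.
  by rewrite hxi1 => /eqP; rewrite oner_eq0.
apply: xn; apply: val_inj; rewrite raddf0; apply: (hno' i).
  exact: subhilb_valP.
move=> n; rewrite -tauE; congr val; apply/eqP; rewrite -subr_eq0 -normr_eq0 -Unorm.
rewrite addrC -scaleN1r Ulin UI hx (hxi i n) scaleN1r addNr normr0 //.
Qed.

End OneRep.
End Linked.

(** * The tracial state *)

Section Trace.
Context (R : realType)
  (C : cstarType R) (iota : forall n, 'M[R[i]]_(cdim n) -> C)
  (hC : car_algebra iota) (alpha : C -> C) (halpha : star_automorphism alpha)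
  (A : cstarType R) (j : C -> A).
Hypotheses (jlin : linear j) (jM : forall a b, j (a * b) = j a * j b)
  (jS : forall a, j (star a) = star (j a)) (j1 : j 1 = 1).
Local Notation q := (car_q iota).
Context (ttau : {scalar A}) (htr : tracial_state ttau).

Let jB a b : j (a - b) = j a - j b.
Proof. by have := jlin (-1) b a; rewrite !scaleN1r => h; rewrite addrC h addrC. Qed.

Lemma trace_excising_projection n : ttau (j (alpha (q n))) = (2^-1) ^+ n.
Proof.
have [al aM aS [g _ gK]] := halpha.
have aB a b : alpha (a - b) = alpha a - alpha b.
  by have := al (-1) b a; rewrite !scaleN1r => h; rewrite addrC h addrC.
have a1 : alpha 1 = 1 by have := aM 1 (g 1); rewrite mul1r gK mulr1.
elim: n => [|n IH]; first by rewrite (car_q0 hC) a1 j1 htr.1.2.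
have [v [vv' v'v]] := car_q_halving hC n.
(* Both [v * star v] and [star v * v] have the same trace. *)
have e : ttau (j (alpha (q n.+1))) = ttau (j (alpha (q n))) - ttau (j (alpha (q n.+1))).
  rewrite -[RHS]raddfB -jB -aB -v'v -vv' !aM !jM; exact: htr.2.
have e2 : ttau (j (alpha (q n.+1))) *+ 2 = ttau (j (alpha (q n))).
  by rewrite mulr2n {1}e subrK.
by rewrite exprS -IH -e2 -(mulr_natl (ttau _) 2) mulrA mulVf ?mul1r ?pnatr_eq0.
Qed.

Context (K : hilbertType R) (rho : A -> K -> K) (eta : K).
Hypothesis hgns : gns_triple ttau rho eta.

(** On the dense orbit of the trace vector, [tau (a^* p a) = tau (p a a^* p)] is at most a
constant times [tau p], so the projections tend strongly to [0]; but they fix [x]. *)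
Lemma trace_gns_no_state x : (forall n, rho (j (alpha (q n))) x = x) -> x = 0.
Proof.
have [hrho cl htau] := hgns; move=> hx.
have sq b : `|rho b eta| ^+ 2 = ttau (star b * b).
  by rewrite htau -inner_norm (rep_innerr hrho) (rep_mul hrho).
have [al aM aS _] := halpha.
have pS n : star (j (alpha (q n))) = j (alpha (q n)).
  by rewrite -jS -aS (car_q_star hC).
have pp n : j (alpha (q n)) * j (alpha (q n)) = j (alpha (q n)).
  by rewrite -jM -aM (car_q_idem hC).
have pn n y : `|rho (j (alpha (q n))) y| <= `|y|.
  by apply: (rep_proj_norm hrho); rewrite pS pp.
apply: small_norm0 => e e0; have e2 : 0 < e / 2 by rewrite divr_gt0.
have [a ha] : exists a, `|rho a eta - x| < e / 2.
  by apply: density_dist => //; rewrite cl.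
have [c c0 hc] := bounded_op_bound (rep_bounded hrho (star a)).
have bound n : `|rho (j (alpha (q n))) (rho a eta)| ^+ 2 <= c ^+ 2 * (2^-1) ^+ n.
  set P := j (alpha (q n)).
  have -> : `|rho P (rho a eta)| ^+ 2 = `|rho (star a) (rho P eta)| ^+ 2.
    by rewrite -!(rep_mul hrho) !sq !starM starK htr.2 pS.
  have -> : (2^-1) ^+ n = `|rho P eta| ^+ 2.
    by rewrite sq pS pp trace_excising_projection.
  by rewrite -exprMn ler_sqr ?nnegrE ?mulr_ge0 // ltW.
have [n hn] : exists n, c ^+ 2 * (2^-1) ^+ n < (e / 2) ^+ 2.
  have : 0 < (e / 2) ^+ 2 / c ^+ 2 by rewrite divr_gt0 // exprn_gt0.
  case E : (_ / c ^+ 2) => [d i]; rewrite ltcE /= => /andP[/eqP i0 d0].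
  have sn : (2^-1) ^+ n @[n --> \oo] --> (0 : R).
    by apply: cvg_expr; rewrite ger0_norm; lra.
  have /cvgrPdist_lt /(_ _ d0) [n _ /(_ n (leqnn n))] := sn.
  rewrite /= sub0r normrN ger0_norm ?exprn_ge0 // => hn; exists n.
  rewrite -ltr_pdivlMl ?exprn_gt0 // mulrC E i0.
  have -> : (2^-1 : R[i]) ^+ n = ((2^-1) ^+ n)%:C.
    by rewrite rmorphXn /= fmorphV /= rmorph_nat.
  by rewrite ltcR.
have lt2 : `|rho (j (alpha (q n))) (rho a eta)| < e / 2.
  by rewrite -ltr_sqr ?nnegrE ?(ltW e2) //; apply: le_lt_trans (bound n) hn.
rewrite -(hx n) -(subrK (rho a eta) x) (rep_vecD hrho) [ltRHS]splitr.
apply: le_lt_trans (ler_normD _ _) _; rewrite ltrD //.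
by apply: le_lt_trans (pn _ _) _; rewrite distrC.
Qed.

End Trace.

(** * Flip automorphisms and orthonormal families indexed by paths *)

Section Flip.
Context (R : realType)
  (C : cstarType R) (iota : forall n, 'M[R[i]]_(cdim n) -> C)
  (hC : car_algebra iota) (eps : nat -> bool).
Local Notation q := (car_q iota).
Implicit Types (a b x y : C).

Definition bit (b : bool) : 'I_2 := if b then 1 else 0.

Definition swap_mx : 'M[R[i]]_2 := delta_mx 0 1 + delta_mx 1 0.

(** The selfadjoint unitary of the factor [k] that exchanges the two coordinates when
[eps k] is set. *)
Definition flip_factor k : 'M[R[i]]_2 := if eps k then swap_mx else 1%:M.

(** The analogue of [q n] for the product state that selects the coordinate [eps k] in the
factor [k]. *)
Definition path_projection n : C :=
  iota (elem_tensor (fun k => delta_mx (bit (eps k)) (bit (eps k))) n).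

Let v n : C := iota (elem_tensor flip_factor n).

Lemma swap_mxK : swap_mx *m swap_mx = 1%:M.
Proof.
rewrite /swap_mx mulmxDl !mulmxDr !mul_delta_mx_cond /= !mulr1n !mulr0n add0r addr0.
apply/matrixP => i k; rewrite !mxE; case: i => [] [|[|i]] // hi;
  by case: k => [] [|[|k]] // hk; rewrite -!val_eqE /= ?addr0 ?add0r.
Qed.

Lemma flip_factorK k : flip_factor k *m flip_factor k = 1%:M.
Proof. by rewrite /flip_factor; case: (eps k); rewrite ?swap_mxK ?mulmx1. Qed.

Lemma flip_factor_adj k : map_mx (Num.conj : R[i] -> R[i]) (flip_factor k)^T = flip_factor k.
Proof.
rewrite /flip_factor; case: (eps k); last by rewrite trmx1 map_mx1.
by rewrite /swap_mx linearD /= map_mxD !delta_adj addrC.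
Qed.

Lemma flip_factor_conj k :
  flip_factor k *m delta_mx (bit (eps k)) (bit (eps k)) *m flip_factor k = delta_mx 0 0.
Proof.
rewrite /flip_factor; case: (eps k); last by rewrite mul1mx mulmx1.
by rewrite /swap_mx mulmxDl mulmxDr !mulmxDl !mul_delta_mx_cond /= ?mulr1n ?mulr0n
  ?mul0mx ?add0r ?addr0 ?mul_delta_mx.
Qed.

Let vK n : v n * v n = 1.
Proof.
rewrite /v -(car_mul hC) elem_tensorM -(car_one hC n) -elem_tensor1; congr (iota _).
by apply: eq_elem_tensor => k _; rewrite flip_factorK.
Qed.

Let v_star n : star (v n) = v n.
Proof.
rewrite /v -(car_star hC) elem_tensor_adj; congr (iota _).
by apply: eq_elem_tensor => k _; rewrite flip_factor_adj.
Qed.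

Let v_stable n k (M : 'M[R[i]]_(cdim n)) :
  v (n + k) * iota M * v (n + k) = v n * iota M * v n.
Proof.
elim: k => [|k IH]; first by rewrite addn0.
rewrite -IH addnS {IH}.
have [M' ->] : exists M' : 'M[R[i]]_(cdim (n + k)), iota M = iota M'.
  elim: k => [|k [M' ->]]; first by rewrite addn0; exists M.
  rewrite addnS; exists (M' *t (1%:M : 'M[R[i]]_2)).
  by rewrite -[LHS](car_compat hC).
rewrite -{1}(car_compat hC M') /v -!(car_mul hC) /=.
rewrite !tensmx_mul mulmx1 flip_factorK; exact: (car_compat hC).
Qed.

Let cnorm_v n : cnorm (v n) <= 1.
Proof.
have le1 (x : R) : x = x ^+ 2 -> x <= 1.
  move=> /eqP; rewrite expr2 eq_sym -subr_eq0 -{3}(mulr1 x) -mulrBr mulf_eq0 subr_eq0.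
  by move=> /orP[/eqP ->|/eqP ->].
have c1 : cnorm (1 : C) <= 1 by apply: le1; rewrite -cstar_identity star1 mulr1.
have : cnorm (v n) ^+ 2 <= 1 by rewrite -cstar_identity v_star vK.
by rewrite -[X in _ <= X](expr1n _ 2) ler_sqr ?nnegrE ?cnorm_ge0.
Qed.

Let cnorm_conj n x : cnorm (v n * x * v n) <= cnorm x.
Proof.
have v0 := cnorm_ge0 (v n); have x0 := cnorm_ge0 x.
apply: le_trans (cnormM _ _) _; rewrite -[leRHS]mulr1.
apply: ler_pM => //; first exact: cnorm_ge0.
apply: le_trans (cnormM _ _) _; rewrite -[leRHS]mul1r; exact: ler_pM.
Qed.

(** Convergence in [cnorm], which is not the norm of a normed module structure on [C]. *)
Definition cnorm_lim (u : nat -> C) x :=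
  forall e : R, 0 < e -> exists N, forall n, (N <= n)%N -> cnorm (u n - x) <= e.

Lemma cnorm_lim_uniq u x y : cnorm_lim u x -> cnorm_lim u y -> x = y.
Proof.
move=> hx hy; apply/eqP; rewrite -subr_eq0; apply/eqP.
apply: (bd_sep (cnorm_bound C)) => e e0; have e2 : 0 < e / 2 by lra.
have [N hN] := hx _ e2; have [M hM] := hy _ e2.
have := hN _ (leq_maxl N M); have := hM _ (leq_maxr N M); set k := maxn N M => h1 h2.
rewrite -(subrK (u k) x) -addrA; apply: le_trans (cnormD _ _) _.
by rewrite cnormB [leRHS]splitr lerD.
Qed.

Lemma cnorm_lim_comb c u x u' x' : cnorm_lim u x -> cnorm_lim u' x' ->
  cnorm_lim (fun n => c *: u n + u' n) (c *: x + x').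
Proof.
move=> hx hx' e e0.
have [t t0 tc] := ge0_realC (normr_ge0 c).
have d0 : 0 < e / 2 / (t + 1) by rewrite divr_gt0 //; lra.
have e2 : 0 < e / 2 by lra.
have [N hN] := hx _ d0; have [M hM] := hx' _ e2; exists (maxn N M) => n.
rewrite geq_max => /andP[/hN h1 /hM h2].
rewrite opprD addrACA -scalerBr; apply: le_trans (cnormD _ _) _.
have -> : cnorm (c *: (u n - x)) = t * cnorm (u n - x).
  have := cnormZ c (u n - x); rewrite -tc -rmorphM /= => /eqP.
  by rewrite eq_complex => /andP[/eqP].
rewrite [leRHS]splitr lerD //.
apply: le_trans (_ : (t + 1) * (e / 2 / (t + 1)) <= _).
  by apply: ler_pM => //; [exact: cnorm_ge0|lra].
by rewrite mulrC divfK //; lra.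
Qed.

Lemma cnorm_lim_mul u x u' x' : (forall n, cnorm (u n) <= cnorm x) ->
  cnorm_lim u x -> cnorm_lim u' x' -> cnorm_lim (fun n => u n * u' n) (x * x').
Proof.
move=> ub hx hx' e e0; have x0 := cnorm_ge0 x; have x'0 := cnorm_ge0 x'.
pose t := cnorm x + cnorm x' + 1.
have t0 : 0 < t by rewrite /t; lra.
have d0 : 0 < e / t by rewrite divr_gt0.
have [N hN] := hx _ d0; have [M hM] := hx' _ d0; exists (maxn N M) => n.
rewrite geq_max => /andP[/hN h1 /hM h2].
have -> : u n * u' n - x * x' = u n * (u' n - x') + (u n - x) * x'.
  by rewrite mulrBr mulrBl addrA subrK.
apply: le_trans (cnormD _ _) _.
have b1 : cnorm (u n * (u' n - x')) <= cnorm x * (e / t).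
  by apply: le_trans (cnormM _ _) _; apply: ler_pM => //; exact: cnorm_ge0.
have b2 : cnorm ((u n - x) * x') <= (e / t) * cnorm x'.
  by apply: le_trans (cnormM _ _) _; apply: ler_pM => //; exact: cnorm_ge0.
apply: le_trans (lerD b1 b2) _; rewrite mulrC -mulrDr.
have {2}-> : e = e / t * t by rewrite divfK // gt_eqF.
by rewrite ler_pM2l // /t; lra.
Qed.

(** Conjugation by [v n] is constant from the stage of [x] on, for [x] in the dense union of
the stages, and it does not increase the norm. *)
Lemma flip_limit x : exists y, cnorm_lim (fun n => v n * x * v n) y.
Proof.
apply: (bd_complete (cnorm_bound C)) => e e0; have e2 : 0 < e / 2 by lra.
(* From the stage of the approximant [iota M] on, the conjugates of [x] stay within
   [e / 2] of a fixed element. *)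
have [n [M hM]] := car_dense hC x e2; exists n => k m nk nm.
have near_v i : (n <= i)%N -> cnorm (v i * x * v i - v n * iota M * v n) <= e / 2.
  move=> /subnKC <-; rewrite -(v_stable (i - n)) -mulrBl -mulrBr.
  by apply: le_trans (cnorm_conj _ _) (ltW hM).
rewrite -(subrK (v n * iota M * v n) (v k * x * v k)) -addrA.
apply: le_trans (cnormD _ _) _; rewrite [leRHS]splitr lerD ?near_v //.
by rewrite cnormB near_v.
Qed.

(** The pointwise limit of the conjugations by the [v n] is a *-homomorphism, and it is an
involution because each [v n] is one. *)
Lemma flip_automorphism : exists beta : C -> C,
  [/\ star_automorphism beta & forall n, beta (path_projection n) = q n].
Proof.
have [beta hb] := choice flip_limit.
have on_stage n (M : 'M[R[i]]_(cdim n)) : beta (iota M) = v n * iota M * v n.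
  apply: (cnorm_lim_uniq (hb _)) => e e0; exists n => k /subnKC <-.
  by rewrite v_stable subrr cnorm0 ltW.
have bnorm x : cnorm (beta x) <= cnorm x.
  apply/ler_addgt0Pl => e e0; have [n hn] := hb x _ e0.
  have := hn n (leqnn n); set y := v n * x * v n => hy.
  rewrite -(subrK y (beta x)); apply: le_trans (cnormD _ _) _.
  by rewrite cnormB lerD // cnorm_conj.
have blin : linear beta.
  move=> c a b; apply: (cnorm_lim_uniq (hb _)).
  rewrite (_ : (fun n => _) = fun n => c *: (v n * a * v n) + v n * b * v n).
    exact: cnorm_lim_comb.
  by apply/funext => n; rewrite mulrDr mulrDl -scalerAr -scalerAl.
have bB a b : beta (a - b) = beta a - beta b.
  by have := blin (-1) b a; rewrite !scaleN1r => h; rewrite addrC h addrC.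
have bK x : beta (beta x) = x.
  apply/eqP; rewrite -subr_eq0; apply/eqP/(bd_sep (cnorm_bound C)) => e e0.
  have e2 : 0 < e / 2 by lra.
  have [n [M hM]] := car_dense hC x e2.
  have bbM : beta (beta (iota M)) = iota M.
    rewrite on_stage; have -> : v n * iota M * v n =
        iota (elem_tensor flip_factor n *m M *m elem_tensor flip_factor n).
      by rewrite !(car_mul hC).
    by rewrite on_stage !(car_mul hC) -!/(v n) !mulrA vK mul1r -mulrA vK mulr1.
  have -> : beta (beta x) - x = beta (beta (x - iota M)) - (x - iota M).
    by rewrite !bB bbM opprB addrA subrK.
  apply: le_trans (cnormD _ _) _; rewrite cnormN [leRHS]splitr lerD ?(ltW hM) //.
  by apply: le_trans (bnorm _) (le_trans (bnorm _) (ltW hM)).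
have bnormE x : cnorm (beta x) = cnorm x.
  by apply/eqP; rewrite eq_le bnorm -{1}(bK x) bnorm.
exists beta; split; last first.
  move=> n; rewrite /path_projection on_stage /v -!(car_mul hC) !elem_tensorM.
  by congr (iota _); apply: eq_elem_tensor => k _; exact: flip_factor_conj.
split=> //; last by exists beta.
- move=> a b; apply: (cnorm_lim_uniq (hb _)).
  rewrite (_ : (fun n => _) = fun n => (v n * a * v n) * (v n * b * v n)).
    by apply: cnorm_lim_mul => // n; rewrite bnormE cnorm_conj.
  by apply/funext => n; rewrite !mulrA -(mulrA (v n * a) (v n)) vK mulr1.
- move=> a; apply: (cnorm_lim_uniq (hb _)) => e /(hb a) [N hN]; exists N => n /hN.
  rewrite -cnorm_star starB !starM !v_star mulrA //.
Qed.

Lemma path_projection_star n : star (path_projection n) = path_projection n.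
Proof.
rewrite /path_projection -(car_star hC) elem_tensor_adj; congr (iota _).
by apply: eq_elem_tensor => k _; rewrite delta_adj.
Qed.

End Flip.

Section Paths.
Context (R : realType)
  (C : cstarType R) (iota : forall n, 'M[R[i]]_(cdim n) -> C)
  (hC : car_algebra iota).

Lemma path_projection_orth (eps del : nat -> bool) k : eps k <> del k ->
  path_projection iota eps k.+1 * path_projection iota del k.+1 = 0.
Proof.
move=> ed; rewrite /path_projection -(car_mul hC) /= tensmx_mul.
have -> : delta_mx (bit (eps k)) (bit (eps k)) *m delta_mx (bit (del k)) (bit (del k))
    = 0 :> 'M[R[i]]_2.
  rewrite mul_delta_mx_cond; move: ed; case: (eps k); case: (del k) => // _;
  by rewrite /bit -!val_eqE /= mulr0n.
by rewrite tensmx0 -(subrr 0) (car_iotaB hC) subrr.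
Qed.

End Paths.

Lemma cantor_bool_seq (f : (nat -> bool) -> nat) : ~ injective f.
Proof.
(* The diagonal sequence: at [f d] it differs from the only candidate [d]. *)
move=> finj; pose d n := `[< exists e, f e = n /\ e n = false >].
have [dt|df] := boolP (d (f d)).
  have [e [/finj -> e0]] := asboolW dt; by rewrite dt in e0.
by move: (df) => /asboolP; apply; exists d; split => //; apply/negbTE.
Qed.

(** Two vectors of an orthonormal family are at distance greater than [1], so they cannot
have a common approximant within [1 / 2] in the countable dense set. *)
Lemma separable_no_orthonormal_paths (R : realType) (K : hilbertType R)
    (z : (nat -> bool) -> K) : separable_space K ->
  (forall e, `|z e| = 1) -> (forall e d, e <> d -> inner (z e) (z d) = 0) -> False.
Proof.
move=> [D /countable_injP [f finj] dD] z1 zo.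
have near_z e : exists y, D y /\ `|z e - y| < 2^-1.
  have h0 : 0 < 2^-1 :> R[i] by rewrite invr_gt0.
  have [y [yb yD]] := dD (ball (z e) 2^-1) (ex_intro _ _ (ballxx _ h0)) (ball_open (z e) 2^-1).
  by exists y; split => //; move: yb; rewrite -ball_normE.
have [y hy] := choice near_z.
apply: (@cantor_bool_seq (fun e => f (y e))) => e d /finj.
rewrite !inE => /(_ (hy e).1 (hy d).1) yy; apply: contrapT => ed.
have lt1 : `|z e - z d| < 1.
  rewrite -(subrK (y e) (z e)) -addrA; apply: le_lt_trans (ler_normD _ _) _.
  rewrite [ltRHS]splitr mul1r ltrD ?(hy e).2 // yy distrC; exact: (hy d).2.
have : `|z e - z d| ^+ 2 = 2.
  rewrite -inner_norm innerBl !innerBr !inner_norm !z1 (zo _ _ ed).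
  by rewrite (zo d e) ?expr1n ?subr0 ?sub0r ?opprK // => /esym.
move=> e2; have : `|z e - z d| ^+ 2 < 1 by rewrite expr_lt1.
by rewrite e2 => /lt_gtF; rewrite ltr1n.
Qed.

(** * Separable representations *)

Section SeparableRepresentations.
Unset Implicit Arguments.
Context (R : realType)
  (C : cstarType R) (iota : forall n, 'M[R[i]]_(cdim n) -> C)
  (hC : car_algebra iota)
  (I : Type) (r : I) (alpha : I -> C -> C)
  (halpha : forall i, star_automorphism (alpha i))
  (halpha_r : forall a, alpha r a = a)
  (s : I -> nat -> C)
  (A : cstarType R) (j : C -> A) (l : I -> A)
  (hj : linked (car_q iota) alpha s j l)
  (Hs : I -> hilbertType R) (pi : forall i, C -> Hs i -> Hs i)
  (xi : forall i, Hs i)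
  (hirr : forall i, nonzero_irreducible_rep (pi i))
  (hclass : forall (K : hilbertType R) (sigma : C -> K -> K),
    nonzero_irreducible_rep sigma ->
    exists! i, unitarily_equivalent sigma (pi i))
  (hxi : forall i, excised iota alpha i (pi i) (xi i))
  (hxi1 : forall i, inner (xi i) (xi i) = 1)
  (K : hilbertType R) (rho : A -> K -> K) (hrho : representation rho).
Set Implicit Arguments.

Let xi_neq0 i : xi i <> 0.
Proof. by move=> e; have := hxi1 i; rewrite e inner0l => /eqP; rewrite eq_sym oner_eq0. Qed.

Lemma unit_multiple (L : hilbertType R) (x : L) : x <> 0 ->
  inner (`|x|^-1 *: x) (`|x|^-1 *: x) = 1.
Proof. by move=> /eqP x0; rewrite inner_norm normfZV ?expr1n. Qed.

(** Composing [pi r] with the flip automorphism gives an irreducible representation in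
which [xi r] is fixed by the projections along the path; the family contains a copy of it. *)
Lemma irreducible_path_vector (eps : nat -> bool) : exists i y,
  y <> 0 /\ forall n, pi i (path_projection iota eps n) y = y.
Proof.
have [beta [[blin bM bS bbij] bE]] := flip_automorphism hC eps.
have [hr [a0 [x0 _ ax0]] irr] := hirr r.
have [g gK bK] := bbij.
have [|i [[U [Ulin Uin _ UI]] _]] := hclass _ (fun a => pi r (beta a)).
  split; first exact: rep_twist.
  - by exists (g a0), x0 => //; rewrite bK.
  - move=> N [hN NI]; apply: irr; split=> // a x Nx; rewrite -(bK a); exact: NI.
exists i, (U (xi r)); split.
  move=> e; apply: (@xi_neq0 r); apply/eqP; rewrite -normr_eq0.
  by rewrite -(norm_inner_eq (Uin _ _)) e normr0.
move=> n; rewrite -UI bE; congr U.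
by have := hxi r n; rewrite halpha_r.
Qed.

(** The unitaries move a vector of state [phi i0] to one of state [phi r], and then to one
of state [phi i], where [pi i] has a vector along [eps]. The copy of [pi i] generated by
the latter contains the vector wanted. *)
Lemma path_vector i0 x : x <> 0 -> has_state iota alpha j rho i0 x ->
  forall eps, exists z : K, `|z| = 1 /\
    forall n, rho (j (path_projection iota eps n)) z = z.
Proof.
move=> x0 hx eps; have [i [y [y0 hy]]] := irreducible_path_vector eps.
have hrj := restricted_rep hj hrho.
have hx1 := has_state_rep1 hrho hx.
have xr0 := linked_neq0 hj hrho (i := i0) hx1 x0.
have hxr := has_state_move halpha_r hj hrho hx.
have hxr1 := has_state_rep1 hrho hxr.
have hxi' := has_state_move_back hC halpha halpha_r hj hrho i hxr.
have xi0 := linked_star_neq0 hj hrho (i := i) hxr1 xr0.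
set x' := rho (star (l i)) _ in hxi' xi0.
have [hpi _ _] := hirr i.
have [|||z z0 hz] := @fixed_vector_transfer _ _ _ _ (pi i) (fun a => rho (j a))
    (xi i) (`|x'|^-1 *: x') hpi hrj _ _ (range (path_projection iota eps)) y y0.
- move=> a; apply: (excised_same_state hC halpha a hpi hrj (hxi i)).
    exact: excised_scale.
  by rewrite hxi1 unit_multiple.
- by apply: irreducible_cyclic (hirr i) _.
- by move=> _ [n _ <-].
exists (`|z|^-1 *: z); split; first by rewrite normfZV //; apply/eqP.
by move=> n; rewrite (rep_vecZ hrho) hz //; exists n.
Qed.

Lemma separable_no_state i x : separable_space K ->
  has_state iota alpha j rho i x -> x = 0.
Proof.
move=> sK hx; apply: contrapT => x0.
have /choice [z hz] := path_vector x0 hx.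
apply: (separable_no_orthonormal_paths (z := z) sK) => [e|e d ed]; first exact: (hz e).1.
have [k kk] : exists k, e k <> d k.
  by apply: contrapT => h; apply: ed; apply/funext => k; apply: contrapT => hk; apply: h; exists k.
rewrite -((hz e).2 k.+1) -((hz d).2 k.+1) (rep_innerl hrho) -(rep_mul hrho).
rewrite -(linked_star hj) (path_projection_star hC) -(linked_mul hj).
by rewrite (path_projection_orth hC kk) (rep0 (restricted_rep hj hrho)) inner0r.
Qed.

End SeparableRepresentations.

(** * The theorem *)

Theorem corollary6p1 (R : realType)
  (* CAR algebra *)
  (C : cstarType R) (iota : forall n, 'M[R[i]]_(cdim n) -> C)
  (hC : car_algebra iota)
  (* pure-state data *)
  (I : Type) (r : I) (phi : I -> {scalar C})
  (Hs : I -> hilbertType R) (pi : forall i, C -> Hs i -> Hs i)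
  (xi : forall i, Hs i)
  (hpure : forall i, pure_state (phi i))
  (hgns : forall i, gns_triple (phi i) (pi i) (xi i))
  (hirr : forall i, nonzero_irreducible_rep (pi i))
  (hclass : forall (K : hilbertType R) (sigma : C -> K -> K),
    nonzero_irreducible_rep sigma ->
    exists! i, unitarily_equivalent sigma (pi i))
  (hphir : first_coordinate_product_state iota (phi r))
  (alpha : I -> C -> C)
  (halpha : forall i, star_automorphism (alpha i))
  (halpha_phi : forall i a, phi i (alpha i a) = phi r a)
  (halpha_r : forall a, alpha r a = a)
  (halpha_inner : forall i, asymptotically_inner (alpha i))
  (p e : I -> nat -> C)
  (hp : forall i n, p i n = alpha i (car_q iota n))
  (he : forall i n, e i n = p i n - p i n.+1)
  (w : I -> nat -> C)
  (hw_source : forall i n, star (w i n) * w i n = e i n)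
  (hw_range : forall i n, w i n * star (w i n) = car_f iota n)
  (hw_r : forall n, w r n = car_f iota n)
  (s : I -> nat -> C)
  (hs : forall i N, s i N = \sum_(n < N) w i n)
  (* the representation Pi of C on H, the direct sum of the representations pi i *)
  (H : hilbertType R) (V : forall i, Hs i -> H)
  (hH : hilbert_direct_sum V)
  (Pi : C -> H -> H) (hPi : representation Pi)
  (hPi_sum : forall a i x, Pi a (V i x) = V i (pi i a x))
  (zeta : I -> H) (hzeta : forall i, zeta i = V i (xi i))
  (S : I -> H -> H)
  (hS : forall i x, Pi (s i N) x @[N --> \oo] --> S i x)
  (L : I -> H -> H)
  (hL : forall i x, L i x = S i x + theta (zeta r) (zeta i) x)
  (* A, identified with the concrete algebra it is by the inclusion in B(H) *)
  (A : cstarType R) (incl : A -> H -> H)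
  (hincl : representation incl) (hincl_inj : injective incl)
  (hA : range incl = cstar_generated (range Pi `|` range L)) :
  (forall (K : hilbertType R) (rho : A -> K -> K),
     representation rho -> separable_space K ->
     ~ (nonzero_on rho setT /\ irreducible_on rho setT)) /\
  (forall ttau : {scalar A}, tracial_state ttau ->
     forall (K : hilbertType R) (rho : A -> K -> K) (eta : K),
     gns_triple ttau rho eta ->
     forall M : set K, invariant_subspace rho M ->
     ~ (nonzero_on rho M /\ irreducible_on rho M)).
Proof.
have [j [l hj]] := construction_linked hC hpure hgns hirr hclass hphir halpha
  halpha_phi halpha_r hH hPi hPi_sum hzeta hp he hw_source hw_range hs hS hL
  hincl hincl_inj hA.
have hxi i := gns_excised hC hpure hgns hphir halpha halpha_phi i.
have hxi1 i := gns_norm hpure hgns i.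
split=> [K rho hrho sK [nz irr]|ttau htr K rho eta hg M invM [nz irr]].
  have invK : invariant_subspace rho setT by split => //; split => //; exact: closedT.
  have [i [x [_ x0 hx]]] := irreducible_has_state hC halpha halpha_r hj hrho hclass
    hxi hxi1 invK nz irr.
  apply: x0.
  exact: (separable_no_state hC halpha halpha_r hj hirr hclass hxi hxi1 hrho sK hx).
have [hrho _ _] := hg.
have [i [x [_ x0 hx]]] := irreducible_has_state hC halpha halpha_r hj hrho hclass
  hxi hxi1 invM nz irr.
apply: x0; apply: (trace_gns_no_state hC (halpha i) (linked_linear hj)
  (linked_mul hj) (linked_star hj) (linked_one hj) htr hg); exact: hx.
Qed.
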